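(* Consider a $K$-armed stochastic bandit with reward distributions $P_1,\dots,P_K$, where $P_j$ has mean $\mu_j$ and finite variance $\sigma_j^2<\infty$, and suppose there is an arm $j^*\in[K]$ with $\mu_{j^*}>\max_{j\ne j^*}\mu_j$. Let $\Theta\subseteq\mathbb{R}^K$ contain the true mean vector $\mu=(\mu_1,\dots,\mu_K)$, and run MINTS with the uniform prior over $[K]$, the Gaussian likelihood with $\sigma=1$, and parameter space $\Theta$. (1) If $\Theta=\mathbb{R}^K$, then $$\lim_{T\to\infty}\frac{\mathrm{Regret}(T)}{\log T}=\sum_{j\ne j^*}\frac{2}{\Delta_j}\qquad\text{almost surely.}$$ (2) If $\Theta$ is the unimodal set $$\Theta=\bigcup_{j=1}^K\left\{\theta\in\mathbb{R}^K:\ \theta_1\le\cdots\le\theta_j\ \text{and}\ \theta_j\ge\cdots\ge\theta_K\right\},$$ then $$\lim_{T\to\infty}\frac{\mathrm{Regret}(T)}{\log T}=\sum_{j:\,|j-j^*|=1}\frac{2}{\Delta_j}\qquad\text{almost surely,}$$ where the sum is over $j\in[K]$.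
   Context: Notation: $[K]=\{1,\dots,K\}$. Each arm $j\in[K]$ has a reward distribution $P_j$ on $\mathbb{R}$ with mean $\mu_j$; $\Delta_j=\max_{k\in[K]}\mu_k-\mu_j$ is its suboptimality gap. At each period $t=1,2,\dots$ the agent picks an arm $x_t\in[K]$ and receives feedback $\phi_t$, which conditionally on the past data and $x_t$ is drawn from $P_{x_t}$. The dataset is $\mathcal{D}_0=\varnothing$, $\mathcal{D}_t=\mathcal{D}_{t-1}\cup\{(x_t,\phi_t)\}$. The regret is $\mathrm{Regret}(T)=\sum_{t=1}^T\Delta_{x_t}$. MINTS (minimalist Thompson sampling) with prior $Q_0$ on $[K]$, Gaussian likelihood with parameter $\sigma>0$, and parameter space $\Theta\subseteq\mathbb{R}^K$: the likelihood is $$L(\theta;\mathcal{D}_t)=\prod_{i=1}^t\frac{1}{\sqrt{2\pi}\,\sigma}\exp\left(-\frac{(\theta_{x_i}-\phi_i)^2}{2\sigma^2}\right),\quad \theta\in\Theta.$$ For $j\in[K]$ let $\Theta_j=\{v\in\Theta: v_j\ge v_k\ \forall k\in[K]\}$ and define the profile likelihood $\bar L(j;\mathcal{D}_t)=\sup_{v\in\Theta_j}L(v;\mathcal{D}_t)$. The generalized posterior is $Q_t(j)=\bar L(j;\mathcal{D}_t)Q_0(j)\big/\sum_{k=1}^K\bar L(k;\mathcal{D}_t)Q_0(k)$. At each period $t$, conditionally on $\mathcal{D}_{t-1}$, the arm $x_t$ is sampled from $Q_{t-1}$. The Gaussian model only defines the algorithm; the true rewards need not be Gaussian. *)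

(* Defs.v *)
From HB Require Import structures.
From mathcomp Require Export all_boot all_order all_algebra.
From mathcomp Require Export all_classical all_reals all_analysis.
Export Order.TTheory GRing.Theory Num.Theory.
Export numFieldNormedType.Exports.


#[export] Set Implicit Arguments.
#[export] Unset Strict Implicit.
#[export] Unset Printing Implicit Defensive.

Local Open Scope classical_set_scope.
Local Open Scope ring_scope.

(* Conventions: arms are 'I_K, so arm j of {1, ..., K} is the ordinal j - 1.
   Periods are numbered from 0, so x t and phi t are the arm and the feedback of
   period t + 1, and [dataset x phi t w] consists of the first t periods. *)

Section mints.
Context {R : realType} {K : nat}.

Definition gap (mu : 'I_K -> R) (j : 'I_K) : R :=
  \big[Num.max/mu j]_(k < K) mu k - mu j.

(* A list rather than a set, so that repeated observations are all kept. *)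
Definition data : Type := seq ('I_K * R).

Definition likelihood (sigma : R) (theta : 'I_K -> R) (D : data) : R :=
  \prod_(o <- D) ((Num.sqrt (2 * pi) * sigma)^-1 *
                  expR (- ((theta o.1 - o.2) ^+ 2 / (2 * sigma ^+ 2)))).

Definition argmax_region (Theta : set ('I_K -> R)) (j : 'I_K) :
    set ('I_K -> R) :=
  [set v | Theta v /\ forall k, v k <= v j].

Definition profile_likelihood (sigma : R) (Theta : set ('I_K -> R)) (j : 'I_K)
    (D : data) : R :=
  sup [set likelihood sigma v D | v in argmax_region Theta j].

Definition posterior (sigma : R) (Theta : set ('I_K -> R)) (Q0 : 'I_K -> R)
    (D : data) (j : 'I_K) : R :=
  profile_likelihood sigma Theta j D * Q0 j /
  \sum_(k < K) profile_likelihood sigma Theta k D * Q0 k.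

Definition uniform_prior (j : 'I_K) : R := K%:R^-1.

Definition unimodal_set : set ('I_K -> R) :=
  \bigcup_(j in [set: 'I_K])
    [set theta | (forall i k : 'I_K, (i <= k <= j)%N -> theta i <= theta k) /\
                 (forall i k : 'I_K, (j <= i <= k)%N -> theta k <= theta i)].

Section run.
Context {d : measure_display} {Omega : measurableType d}.
Variable P : probability Omega R.
Variable x : nat -> Omega -> 'I_K.
Variable phi : nat -> {RV P >-> R}.

Definition dataset (t : nat) (w : Omega) : data :=
  [seq (x i w, phi i w) | i <- iota 0 t].

Definition sigma_gen_arm (t : nat) : set (set Omega) :=
  preimage_set_system setT (x t) [set: set 'I_K].

Definition sigma_gen_feedback (t : nat) : set (set Omega) :=
  preimage_set_system setT (phi t) measurable.

(* sigma(D_t) *)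
Definition past (t : nat) : set (set Omega) :=
  <<s \bigcup_(i in [set i | (i < t)%N])
        (sigma_gen_arm i `|` sigma_gen_feedback i) >>.

(* sigma(D_t, x t) *)
Definition past_and_arm (t : nat) : set (set Omega) :=
  <<s past t `|` sigma_gen_arm t >>.

(* The conditional laws are expressed by the defining property of a regular
   conditional distribution: the given kernel integrates to the right value
   over every event of the conditioning sigma-algebra. *)
Record bandit_environment (nu : 'I_K -> probability (measurableTypeR R) R) :
    Prop := {
  arm_measurable : forall t j, measurable (x t @^-1` [set j]) ;
  feedback_law : forall t (A : set Omega) (B : set (measurableTypeR R)),
    past_and_arm t A -> measurable B ->
    P (A `&` phi t @^-1` B) = (\int[P]_(w in A) nu (x t w) B)%E }.

Definition mints_agent (sigma : R) (Theta : set ('I_K -> R)) (Q0 : 'I_K -> R) :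
    Prop :=
  forall t (A : set Omega) (j : 'I_K), past t A ->
    P (A `&` x t @^-1` [set j]) =
    (\int[P]_(w in A) (posterior sigma Theta Q0 (dataset t w) j)%:E)%E.

Definition regret (mu : 'I_K -> R) (T : nat) (w : Omega) : R :=
  \sum_(t < T) gap mu (x t w).

End run.
End mints.

(* Main.v *)
(* Let N_j be the number of pulls of arm j and A_j the sum of its posterior probabilities. Square
   integrable martingale convergence and Kronecker's lemma give, almost surely, N_j - A_j = o(A_j)
   when A_j diverges, and the strong law for the empirical mean of every arm pulled infinitely
   often; the rest is deterministic. The posterior of j is at least a constant times that of any
   adjacent arm as long as N_j is bounded, so every arm is pulled infinitely often and all empirical
   means converge. Fitting a profile whose maximum is at j <> j* then costs about
   sum_i N_i Delta_i^2 / 2, over the arms i <> j* on the geodesic from j to j*, more than the best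
   fit. For an arm adjacent to j* this says
   A_j(t+1) - A_j(t) = exp (- (1 + o(1)) A_j Delta_j^2 / 2), hence A_j ~ (2 / Delta_j^2) log T.
   For any other arm j the geodesic contains a neighbour n of j*, and comparing exp (a A_j) with
   the increments of exp (delta A_n) gives A_j = o(A_n) = o(log T). *)
Require Import Defs.
From mathcomp Require Import measurable_realfun ring lra zify.
Local Open Scope classical_set_scope.
Local Open Scope ring_scope.

(** * Integration against functions measurable for a sub-sigma-algebra *)

Import HBNNSimple.

(** Conditional expectations never appear: the two defining properties of a run only give integrals
    over events of a sigma-algebra, and the martingale argument is carried out with these. The noise
    is merely square integrable and nothing is known at the start about the growth of N_j or A_j, so
    each martingale is weighted by 1 / (1 + its own predictable variance), which yields usable
    bounds whether or not that variance diverges. The cost quoted for a maximum at j supposes that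
    such a profile fits j* well. It may instead misfit j*, at a cost of order N_{j*} minus what the
    arms strictly between j and j* contribute. Hence those arms must first be shown to be pulled
    o(N_{j*}) times, by induction along geodesics, nearest to j* first; only then do the sharp
    exponents come out. The posterior decays in the random N_j; replacing N_j by A_j, whose
    increments are the posteriors themselves, closes the recursion. With c = Delta_j^2 / 2, the
    equation A' = exp (- c A) has the solution log (1 + c T) / c, and Delta_j / c = 2 / Delta_j is
    the regret constant. *)

Section subsigma.
Context {d : measure_display} {Omega : measurableType d} {R : realType}.
Variable G : set (set Omega).
Hypothesis GM : G `<=` measurable.

Lemma g_sigma_measurable (A : set (g_sigma_algebraType G)) :
  measurable A -> measurable (A : set Omega).
Proof.
by apply: smallest_sub => //; exact: sigma_algebra_measurable.
Qed.

Lemma g_sigma_measurable_fun d' (U : measurableType d') (f : Omega -> U) :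
  measurable_fun [set: g_sigma_algebraType G] f -> measurable_fun setT f.
Proof.
move=> mf _ B mB; exact: g_sigma_measurable (mf measurableT B mB).
Qed.

Variable P : probability Omega R.

(** Stands in for conditional expectation. The inequality form serves both the orthogonality of
    increments and the bound on their conditional second moments. *)
Lemma integral_ge0_g_sigma (f Z : Omega -> R) (b : R) :
  P.-integrable setT (EFin \o f) ->
  (forall A, <<s G >> A -> (0 <= \int[P]_(w in A) (f w)%:E)%E) ->
  measurable_fun [set: g_sigma_algebraType G] Z ->
  (forall w, 0 <= Z w <= b) ->
  (0 <= \int[P]_w (Z w * f w)%:E)%E.
Proof.
move=> fint f0 mZ Zb.
have mZ' : measurable_fun [set: g_sigma_algebraType G] (EFin \o Z) by apply/measurable_EFinP.
(* The simple functions live on [g_sigma_algebraType G], so their level sets are events of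
   [<<s G>>], to which the hypothesis on [f] applies. *)
pose g := nnsfun_approx (measurableT : measurable [set: g_sigma_algebraType G]) mZ'.
have cg w : g ^~ w @ \oo --> Z w.
  have := @cvg_nnsfun_approx _ _ _ _ (measurableT : measurable [set: g_sigma_algebraType G]) _ mZ'.
  move=> /(_ _ w I) cg; apply: (fine_cvg (f := EFin \o g ^~ w)); apply: cg.
  by move=> v _ /=; rewrite lee_fin; case/andP: (Zb v).
have mg n : measurable_fun setT (g n : Omega -> R).
  by apply: g_sigma_measurable_fun; exact: measurable_funP.
have gZ n w : 0 <= g n w <= Z w.
  rewrite fun_ge0 /=.
  rewrite -(cvg_lim _ (cg w)) //; apply: nondecreasing_cvgn_le; last first.
    by apply/cvg_ex; exists (Z w); exact: cg.
  by move=> m k mk; exact/lefP/nd_nnsfun_approx.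
have mf : measurable_fun setT f by apply/measurable_EFinP; case/integrableP: fint.
have mgf n : measurable_fun setT (fun w : Omega => (g n w * f w)%:E).
  by apply/measurable_EFinP; exact: (measurable_funM (mg n) mf).
have mZf : measurable_fun setT (fun w => (Z w * f w)%:E).
  by apply/measurable_EFinP; apply: measurable_funM => //; exact: g_sigma_measurable_fun.
have cgf : {ae P, forall w, setT w -> (fun n => (g n w * f w)%:E) @ \oo --> (Z w * f w)%:E}.
  apply: aeW => w _; apply: (@cvg_EFin _ _ _ _ (fun n => (g n w * f w)%:E) (Z w * f w)).
    exact: nearW.
  exact: cvgMr_tmp.
have ib : P.-integrable setT (fun w => (b * `|f w|)%:E).
  rewrite (_ : (fun _ => _) = fun w => (b%:E * `|f w|%:E)%E) //.
  exact/integrableZl/integrable_norm.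
have gb : {ae P, forall (w : Omega) n, setT w -> (`|(g n w * f w)%:E| <= (b * `|f w|)%:E)%E}.
  apply: aeW => w n _; rewrite lee_fin normrM ler_wpM2r //.
  case/andP: (gZ n w) => g0 gZ'; rewrite ger0_norm //.
  by apply: (le_trans gZ'); case/andP: (Zb w).
have [_ _ /= cI] := dominated_convergence measurableT mgf mZf cgf ib gb.
rewrite -(cvg_lim _ cI) //; apply: lime_ge; first by apply/cvg_ex; eexists; exact: cI.
apply: nearW => n.
have -> : (fun w : Omega => (g n w * f w)%:E) =
    fun w => (\sum_(y <- finmap.enum_fset (fset_set (range (g n))))
      (y * (\1_(g n @^-1` [set y]) w * f w))%:E)%E.
  apply/funext => w; rewrite sumEFin {1}fimfunE fsbig_finite //= big_distrl /=.
  by congr EFin; apply: eq_bigr => y _; rewrite mulrA.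
have mgy y : measurable (g n @^-1` [set y] : set Omega).
  by rewrite -[X in measurable X]setTI; exact: mg.
have iy y : P.-integrable setT (fun w : Omega => (\1_(g n @^-1` [set y]) w * f w)%:E).
  pose h := (EFin \o f) \_ ((g n @^-1` [set y]) : set Omega).
  apply: (@eq_integrable _ Omega R P setT measurableT h).
    by move=> w _ /=; rewrite /h patchE indicE; case: ifP => _; rewrite ?mul1r ?mul0r.
  by apply/integrable_restrict => //; rewrite setTI; exact: integrableS fint.
under eq_integral do under eq_bigr do rewrite EFinM.
rewrite integral_sum //; last by move=> y; exact/integrableZl.
rewrite big_seq; apply: sume_ge0 => y.
rewrite in_fset_set ?inE // => -[w _ <-].
rewrite integralZl //; apply: mule_ge0; first by rewrite lee_fin fun_ge0.
rewrite (_ : (fun _ => _) = (EFin \o f) \_ (g n @^-1` [set g n w])); last first.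
  by apply/funext => v; rewrite patchE indicE; case: ifP => _; rewrite ?mul1r ?mul0r.
rewrite -integral_mkcond; apply: f0.
have := measurable_funP (g n) measurableT [set g n w] (measurable_set1 _).
by rewrite setTI.
Qed.
End subsigma.

(** * Orthogonality of increments to bounded functions of the past *)

Section martingale.
Context {d : measure_display} {Omega : measurableType d} {R : realType}.
Variable P : probability Omega R.

Lemma integrable_mul_bounded (f Z : Omega -> R) (b : R) :
  P.-integrable setT (EFin \o f) -> measurable_fun setT Z ->
  (forall w, `|Z w| <= b) -> P.-integrable setT (EFin \o (fun w => Z w * f w)).
Proof.
move=> fint mZ Zb.
apply: (@eq_integrable _ Omega R P setT measurableT ((EFin \o Z) \* (EFin \o f))%E) => //.
apply: integrableMr => //; exists b; split; first exact: num_real.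
by move=> M bM w _; apply: le_trans (Zb w) (ltW bM).
Qed.

Lemma integrable_of_sqr (f : Omega -> R) :
  measurable_fun setT f ->
  P.-integrable setT (EFin \o (fun w => f w ^+ 2)) -> P.-integrable setT (EFin \o f).
Proof.
move=> mf f2.
apply: (@le_integrable _ _ _ P setT measurableT _ (EFin \o (fun w => 1 + f w ^+ 2))).
- exact/measurable_EFinP.
- move=> w _ /=; rewrite lee_fin [leRHS]ger0_norm ?addr_ge0 ?sqr_ge0//.
  by rewrite -real_normK ?num_real//; have := sqr_ge0 (`|f w| - 1); nra.
- have i1 := finite_measure_integrable_cst P 1 measurableT.
  exact: (integrableD measurableT i1 f2).
Qed.

Section orthogonality.
Variables (G : set (set Omega)) (f : Omega -> R).
Hypothesis GM : G `<=` measurable.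
Hypothesis fint : P.-integrable setT (EFin \o f).
Hypothesis f0 : forall A, <<s G >> A -> (\int[P]_(w in A) (f w)%:E = 0)%E.

(** [Z + b] is nonnegative, so the sign lemma applies to it with both [f] and [- f]; the shift by
    [b] is invisible because [f] integrates to 0 over the whole space. *)
Lemma Rintegral_mul_g_sigma_eq0 (Z : Omega -> R) (b : R) :
  measurable_fun [set: g_sigma_algebraType G] Z -> (forall w, `|Z w| <= b) ->
  \int[P]_w (Z w * f w) = 0.
Proof.
move=> mZ Zb; have mZ' := g_sigma_measurable_fun GM mZ.
have iZf := integrable_mul_bounded fint mZ' Zb.
have If : \int[P]_w f w = 0.
  rewrite /Rintegral f0 //; exact: (@measurableT _ (g_sigma_algebraType G)).
have mZb : measurable_fun [set: g_sigma_algebraType G] (fun w => Z w + b).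
  exact: measurable_funD.
have Zb0 w : 0 <= Z w + b <= 2 * b.
  by have := Zb w; rewrite ler_norml => /andP[? ?]; apply/andP; split; lra.
have ibf : P.-integrable setT (EFin \o (fun w => b * f w)).
  by apply: (integrable_mul_bounded (b := `|b|)) => //.
have E (g : Omega -> R) : (0 <= \int[P]_w (g w)%:E)%E -> 0 <= \int[P]_w g w.
  by move=> g0; apply: fine_ge0.
have F0 A : <<s G >> A -> (0 <= \int[P]_(w in A) (f w)%:E)%E by move=> GA; rewrite f0.
have := E _ (integral_ge0_g_sigma GM fint F0 mZb Zb0).
have NF A : <<s G >> A -> (0 <= \int[P]_(w in A) (- f w)%:E)%E.
  move=> GA; under eq_integral do rewrite EFinN.
  have mA : measurable A by apply: (g_sigma_measurable GM).
  rewrite integralN ?f0 ?oppe0 //.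
  by apply: integrable_add_def => //; exact: integrableS fint.
have iN : P.-integrable setT (EFin \o (fun w => - f w)).
  rewrite (_ : _ \o _ = -%E \o (EFin \o f)) //; exact: integrableN.
have := E _ (integral_ge0_g_sigma GM iN NF mZb Zb0).
have -> : \int[P]_w ((Z w + b) * - f w) = - \int[P]_w (Z w * f w).
  transitivity (\int[P]_w (- 1 * (Z w * f w) + (- 1) * (b * f w))).
    by apply: eq_Rintegral => w _; ring.
  rewrite RintegralD // ?RintegralZl // ?If; first by ring.
  - exact: (integrableZl measurableT (-1) iZf).
  - exact: (integrableZl measurableT (-1) ibf).
have -> : \int[P]_w ((Z w + b) * f w) = \int[P]_w (Z w * f w).
  under eq_Rintegral do rewrite mulrDl.
  by rewrite RintegralD // RintegralZl // If mulr0 addr0.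
by move=> ? ?; lra.
Qed.

End orthogonality.
End martingale.

(** * Martingale convergence *)

Section stopped.
Context {d : measure_display} {Omega : measurableType d} {R : realType}.
Variable P : probability Omega R.
Variables (G : nat -> set (set Omega)) (D V : nat -> Omega -> R) (C : R).
Hypothesis GM : forall t, G t `<=` measurable.
Hypothesis GS : forall t, <<s G t>> `<=` <<s G t.+1>>.
Hypothesis mD : forall t, measurable_fun [set: g_sigma_algebraType (G t.+1)] (D t).
Hypothesis mV : forall t, measurable_fun [set: g_sigma_algebraType (G t)] (V t).
Hypothesis V01 : forall t w, 0 <= V t w <= 1.
Hypothesis C0 : 0 <= C.
Hypothesis iD2 : forall t, P.-integrable setT (EFin \o (fun w => D t w ^+ 2)).
Hypothesis D0 : forall t A, <<s G t>> A -> (\int[P]_(w in A) (D t w)%:E = 0)%E.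
Hypothesis D2 : forall t A, <<s G t>> A ->
  (\int[P]_(w in A) (D t w ^+ 2)%:E <= \int[P]_(w in A) (C * V t w)%:E)%E.

Let A n w := \sum_(t < n) V t w.
(** The index [t.+1] keeps [W t] measurable for [G t], since [V t] is, and bounds [W t ^+ 2 * V t]
    by the decrease of 1 / (1 + A) during step t. *)
Let W t w := (1 + A t.+1 w)^-1.
Let M n w := \sum_(t < n) D t w * W t w.

(* Partial sums of the D t * W t from time m, frozen once they reach eps. The factor in front of
   D t is then bounded, so orthogonality holds although D t itself is only square integrable. *)
Fixpoint stopped (m : nat) (eps : R) (n : nat) (w : Omega) : R :=
  if n is t.+1 then
    stopped m eps t w +
    ((m <= t)%N && (`|stopped m eps t w| < eps))%:R * W t w * D t w
  else 0.

Lemma measurable_fun_g_sigmaS s t (f : Omega -> R) : (s <= t)%N ->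
  measurable_fun [set: g_sigma_algebraType (G s)] f ->
  measurable_fun [set: g_sigma_algebraType (G t)] f.
Proof.
move=> + mf; elim: t => [|t IH]; first by rewrite leqn0 => /eqP <-.
rewrite leq_eqVlt => /predU1P[<- //|/IH {}IH].
by move=> _ B mB; apply: GS; apply: IH.
Qed.

Let A_ge0 n w : 0 <= A n w.
Proof. by apply: sumr_ge0 => t _; case/andP: (V01 t w). Qed.

Let W01 t w : 0 < W t w <= 1.
Proof.
rewrite /W invr_gt0 invf_le1 ?ltr_wpDr ?ltr01 //.
by rewrite lerDl A_ge0.
Qed.

Let mW t : measurable_fun [set: g_sigma_algebraType (G t)] (W t).
Proof.
rewrite (_ : W t = fun w => expR (- ln (1 + A t.+1 w))); last first.
  by apply/funext => w; rewrite expRN lnK // posrE ltr_wpDr.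
apply: measurableT_comp => //; apply: measurable_funN.
apply: measurableT_comp => //; apply: measurable_funD => //.
apply: measurable_sum => s.
have st : (s <= t)%N by rewrite -ltnS.
exact: (measurable_fun_g_sigmaS st (@mV s)).
Qed.

Let gate m eps t (y : R) w := ((m <= t)%N && (`|y| < eps))%:R * W t w.

Let mgate m eps t (f : Omega -> R) :
  measurable_fun [set: g_sigma_algebraType (G t)] f ->
  measurable_fun [set: g_sigma_algebraType (G t)] (fun w => gate m eps t (f w) w).
Proof.
move=> mf; apply: measurable_funM; last exact: mW.
case: leqP => _ //=.
rewrite (_ : (fun _ => _) = \1_[set w | `|f w| < eps]); last first.
  by apply/funext => w; rewrite indicE mem_setE.
apply: measurable_indic.
have -> : [set w | `|f w| < eps] = (fun w => `|f w| < eps) @^-1` [set true] by [].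
rewrite -[X in measurable X]setTI; apply: measurable_fun_ltr => //.
exact: measurableT_comp.
Qed.

Lemma measurable_stopped m eps t :
  measurable_fun [set: g_sigma_algebraType (G t)] (stopped m eps t).
Proof.
elim: t => [|t IH] //=.
apply: measurable_funD; first exact: (measurable_fun_g_sigmaS (leqnSn t) IH).
apply: measurable_funM => //.
exact: (measurable_fun_g_sigmaS (leqnSn t) (mgate m eps IH)).
Qed.

Let gate_ge0 m eps t y w : 0 <= gate m eps t y w.
Proof. by rewrite mulr_ge0 // ltW //; case/andP: (W01 t w). Qed.

Let gate_le m eps t y w : gate m eps t y w <= (m <= t)%:R * W t w.
Proof.
rewrite ler_wpM2r //; first by rewrite ltW //; case/andP: (W01 t w).
by rewrite ler_nat; case: (m <= t)%N => //=; case: (_ < _).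
Qed.

Let gate_le1 m eps t y w : gate m eps t y w <= 1.
Proof.
apply: le_trans (gate_le _ _ _ _ _) _.
by case/andP: (W01 t w) => ? ?; case: (m <= t)%N; rewrite ?mul1r ?mul0r.
Qed.

Let gate_mul_le m eps t y w : 0 < eps -> `|y * gate m eps t y w| <= eps.
Proof.
move=> eps0; rewrite normrM (ger0_norm (gate_ge0 _ _ _ _ _)) /gate.
case/andP: (W01 t w) => W0 W1; case: (m <= t)%N; rewrite /= ?mul0r ?mulr0 ?normr0; last exact: ltW.
case: ltP => y_eps; rewrite /= ?mul1r ?mul0r ?mulr0 ?normr0; last exact: ltW.
by apply: le_trans (ltW y_eps); rewrite ler_piMr // ltW.
Qed.

Let mf t (f : Omega -> R) :
  measurable_fun [set: g_sigma_algebraType (G t)] f -> measurable_fun setT f.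
Proof. by move=> ?; apply: (g_sigma_measurable_fun (@GM t)). Qed.

Let iD t : P.-integrable setT (EFin \o D t).
Proof. by apply: integrable_of_sqr => //; exact: (@mf t.+1). Qed.

Let iV t : P.-integrable setT (EFin \o V t).
Proof.
have iV1 : P.-integrable setT (EFin \o (fun w => V t w * 1)).
  apply: (integrable_mul_bounded (b := 1)); first exact: finite_measure_integrable_cst.
  - exact: (@mf t).
  - by move=> w; case/andP: (V01 t w) => *; rewrite ger0_norm.
rewrite (_ : V t = fun w => V t w * 1) //.
by apply/funext => w; rewrite mulr1.
Qed.

Let a t := \int[P]_w (W t w ^+ 2 * V t w).

Let W2 t w : `|W t w ^+ 2| <= 1.
Proof.
case/andP: (W01 t w) => W0 W1; rewrite ger0_norm ?sqr_ge0 //.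
by rewrite expr_le1 // ltW.
Qed.

Let mW2 t : measurable_fun [set: g_sigma_algebraType (G t)] (fun w => W t w ^+ 2).
Proof. by apply: measurable_funX. Qed.

Let iWV t : P.-integrable setT (EFin \o (fun w => W t w ^+ 2 * V t w)).
Proof. by apply: (integrable_mul_bounded (b := 1)) => //; exact: (@mf t). Qed.

Let a_ge0 t : 0 <= a t.
Proof. by apply: Rintegral_ge0 => w _; rewrite mulr_ge0 ?sqr_ge0 //; case/andP: (V01 t w). Qed.

(** One induction gives integrability and the bound. The cross term vanishes because the multiplier
    [Y * U] of [D t] is bounded by [eps]; the squared increment is compared with [C * V t] under the
    weight [U ^+ 2], where [U] is at most [W t], and 0 before time m. *)
Lemma stopped_sqr m eps n : 0 < eps ->
  P.-integrable setT (EFin \o (fun w => stopped m eps n w ^+ 2)) /\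
  \int[P]_w (stopped m eps n w ^+ 2) <= C * \sum_(t < n) (m <= t)%:R * a t.
Proof.
move=> eps0; elim: n => [|t [IHi IHb]] /=.
  rewrite big_ord0 mulr0 expr0n /=; split.
    exact: finite_measure_integrable_cst.
  by rewrite Rintegral_cst // mul0r.
set Y := stopped m eps t; set U := fun w => gate m eps t (Y w) w.
have mY : measurable_fun [set: g_sigma_algebraType (G t)] Y by exact: measurable_stopped.
have mU : measurable_fun [set: g_sigma_algebraType (G t)] U by exact: mgate.
have mYU : measurable_fun [set: g_sigma_algebraType (G t)] (fun w => Y w * U w).
  exact: measurable_funM.
have mU2 : measurable_fun [set: g_sigma_algebraType (G t)] (fun w => U w ^+ 2).
  exact: measurable_funX.
have YU w : `|Y w * U w| <= eps by exact: gate_mul_le.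
have U2 w : `|U w ^+ 2| <= 1.
  by rewrite ger0_norm ?sqr_ge0 // expr_le1 ?gate_ge0 ?gate_le1.
have iYUD := integrable_mul_bounded (@iD t) (mf mYU) YU.
have iU2D := integrable_mul_bounded (@iD2 t) (mf mU2) U2.
have i2 : P.-integrable setT (EFin \o (fun w => 2 * (Y w * U w * D t w))).
  exact: (integrableZl measurableT 2 iYUD).
have E : (fun w => (Y w + U w * D t w) ^+ 2) =
    fun w => Y w ^+ 2 + 2 * (Y w * U w * D t w) + U w ^+ 2 * D t w ^+ 2.
  by apply/funext => w; ring.
have i12 : P.-integrable setT (EFin \o (fun w => Y w ^+ 2 + 2 * (Y w * U w * D t w))).
  exact: (integrableD measurableT IHi i2).
rewrite E; split; first exact: (integrableD measurableT i12 iU2D).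
rewrite RintegralD // RintegralD // RintegralZl //.
rewrite (Rintegral_mul_g_sigma_eq0 (@GM t) (@iD t) (@D0 t) mYU YU) mulr0 addr0.
rewrite big_ord_recr /= mulrDr; apply: lerD => //.
have iCV : P.-integrable setT (EFin \o (fun w => C * V t w)).
  exact: (integrableZl measurableT C (@iV t)).
have iCVD : P.-integrable setT (EFin \o (fun w => C * V t w - D t w ^+ 2)).
  exact: (integrableB measurableT iCV (@iD2 t)).
have CVD A0 : <<s G t>> A0 -> (0 <= \int[P]_(w in A0) (C * V t w - D t w ^+ 2)%:E)%E.
  move=> GA; have mA : measurable A0 by apply: (g_sigma_measurable (@GM t)).
  rewrite integralB_EFin // ?sube_ge0 ?D2 //;
    try exact: integrableS iCV; try exact: integrableS (@iD2 t).
  apply/orP; left; apply: integrable_fin_num => //; exact: integrableS (@iD2 t).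
have U2b w : 0 <= U w ^+ 2 <= 1 by rewrite sqr_ge0 expr_le1 ?gate_ge0 ?gate_le1.
have := integral_ge0_g_sigma (@GM t) iCVD CVD mU2 U2b.
move=> /fine_ge0; rewrite -/(Rintegral _ _ _) => I0.
have iU2CV := integrable_mul_bounded iCV (mf mU2) U2.
have : \int[P]_w (U w ^+ 2 * D t w ^+ 2) <= \int[P]_w (U w ^+ 2 * (C * V t w)).
  rewrite -subr_ge0 -RintegralB //; move: I0.
  by under eq_Rintegral do rewrite mulrBr.
move=> /le_trans; apply.
have iWV1 := @iWV t.
have iWVc : P.-integrable setT (EFin \o (fun w => C * (m <= t)%:R * (W t w ^+ 2 * V t w))).
  exact: (integrableZl measurableT (C * (m <= t)%:R) iWV1).
rewrite mulrA -RintegralZl //.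
apply: le_Rintegral => // w _.
rewrite [X in X <= _](_ : _ = C * V t w * U w ^+ 2); last by ring.
rewrite [X in _ <= X](_ : _ = C * V t w * ((m <= t)%:R * W t w ^+ 2)); last by ring.
rewrite ler_wpM2l ?mulr_ge0 //; first by case/andP: (V01 t w).
have := gate_le m eps t (Y w) w; have := gate_ge0 m eps t (Y w) w.
rewrite -/(U w); case: (m <= t)%N; rewrite ?mul1r ?mul0r => U0 U1.
  by rewrite lerXn2r // nnegrE // (le_trans U0).
have -> : U w = 0 by apply/eqP; rewrite eq_le U0 U1.
by rewrite expr0n.
Qed.

(** The sum telescopes against 1 / (1 + A). *)
Let sum_WV n w : \sum_(t < n) W t w ^+ 2 * V t w <= 1.
Proof.
suff : \sum_(t < n) W t w ^+ 2 * V t w <= 1 - (1 + A n w)^-1.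
  by move/le_trans; apply; rewrite lerBlDr lerDl invr_ge0 addr_ge0.
elim: n => [|n IH]; first by rewrite /A !big_ord0 addr0 invr1 subrr.
rewrite big_ord_recr /=; apply: le_trans (lerD IH (lexx _)) _.
have AS : A n.+1 w = A n w + V n w by rewrite /A big_ord_recr.
have An := A_ge0 n w; case/andP: (V01 n w) => V0 _.
rewrite /W AS; set x := A n w in An *; set v := V n w in V0 *.
have -> : (1 + x)^-1 = (1 + (x + v))^-1 + v / ((1 + x) * (1 + (x + v))).
  by field; apply/andP; split; apply: lt0r_neq0; lra.
suff : (1 + (x + v))^-1 ^+ 2 * v <= v / ((1 + x) * (1 + (x + v))) by lra.
rewrite mulrC ler_wpM2l // expr2 -invfM lef_pV2 ?posrE ?mulr_gt0 //; try lra.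
by rewrite ler_wpM2r; lra.
Qed.

Let sum_a n : \sum_(t < n) a t <= 1.
Proof.
have -> : \sum_(t < n) a t = \int[P]_w (\sum_(t < n) W t w ^+ 2 * V t w).
  elim: n => [|n IH].
    rewrite big_ord0; under eq_Rintegral do rewrite big_ord0.
    by rewrite Rintegral_cst // mul0r.
  rewrite big_ord_recr /= IH.
  under [RHS]eq_Rintegral do rewrite big_ord_recr /=.
  rewrite RintegralD //.
  rewrite (_ : _ \o _ = fun w => (\sum_(t < n) (W t w ^+ 2 * V t w)%:E)%E).
    by apply: integrable_sum => // t _; exact: iWV.
  by apply/funext => w /=; rewrite sumEFin.
apply: le_trans (_ : \int[P]_w (1 : R) <= 1); last first.
  by rewrite Rintegral_cst // mul1r; have -> : fine (P setT) = 1 by rewrite probability_setT.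
apply: le_Rintegral => //.
  rewrite (_ : _ \o _ = fun w => (\sum_(t < n) (W t w ^+ 2 * V t w)%:E)%E).
    by apply: integrable_sum => // t _; exact: iWV.
  by apply/funext => w /=; rewrite sumEFin.
exact: finite_measure_integrable_cst.
Qed.

Let tail_a (e : R) : 0 < e -> exists m, forall n, \sum_(t < n) (m <= t)%:R * a t <= e.
Proof.
move=> e0; pose s n := \sum_(t < n) a t.
have snd : nondecreasing_seq s.
  by apply/nondecreasing_seqP => n; rewrite /s big_ord_recr /= lerDl.
have scv : cvgn s.
  by apply: nondecreasing_is_cvgn => //; exists 1 => _ [n _ <-]; exact: sum_a.
have [m _ Hm] := iffLR (cvgrPdist_lt _ _) scv e e0.
exists m => n.
(* [maxn] keeps the formula valid for n < m, where every term is 0. *)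
have -> : \sum_(t < n) (m <= t)%:R * a t = s (maxn n m) - s m.
  elim: n => [|n IH]; first by rewrite big_ord0 max0n subrr.
  rewrite big_ord_recr /= IH; have [mn|] := boolP (m <= n)%N.
    rewrite (maxn_idPl mn) (maxn_idPl (leqW mn)) /s big_ord_recr /= mul1r.
    by rewrite addrAC.
  rewrite -ltnNge => mn; by rewrite mul0r addr0 (maxn_idPr (ltnW mn)) (maxn_idPr mn).
have := Hm m (leqnn m); have := nondecreasing_cvgn_le snd scv (maxn n m).
by rewrite ltr_norml => ? /andP[? ?]; lra.
Qed.

Let stopped_stay m eps n k w : (n <= k)%N -> eps <= `|stopped m eps n w| ->
  stopped m eps k w = stopped m eps n w.
Proof.
move=> /subnKC <- h; elim: (k - n)%N => [|j IH]; first by rewrite addn0.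
by rewrite addnS /= IH ltNge h andbF mul0r mul0r addr0.
Qed.

(** Freezing makes the events [B n] increase in n, so Chebyshev's inequality at a fixed time and
    continuity of [P] from below do the work of a maximal inequality. *)
Let stopped_escape m (e r : R) : 0 < e ->
  (forall n, \sum_(t < n) (m <= t)%:R * a t <= r) ->
  (P (\bigcup_n [set w | (e <= `|stopped m e n w|)%R]) <=
   (C * r / e ^+ 2)%:E)%E.
Proof.
move=> e0 tr; pose B (n : nat) := [set w | e <= `|stopped m e n w|].
rewrite -[X in (P X <= _)%E]/(\bigcup_n B n).
have mB n : measurable (B n).
  have -> : B n = (fun w => e <= `|stopped m e n w|) @^-1` [set true] by [].
  rewrite -[X in measurable X]setTI; apply: measurable_fun_ler => //.
  by apply: measurableT_comp => //; apply: (@mf n); exact: measurable_stopped.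
have Bnd : nondecreasing_seq B.
  by move=> i j ij; apply/subsetPset => w; rewrite /B /= => h; rewrite (stopped_stay ij h).
have cB := @nondecreasing_cvg_mu _ _ _ P _ mB (bigcupT_measurable _ mB) Bnd.
rewrite -(cvg_lim _ cB) //; apply: lime_le; first by apply/cvg_ex; eexists; exact: cB.
apply: nearW => n /=.
have [i2 b2] := stopped_sqr m n e0.
have e2 : 0 < e ^+ 2 by rewrite exprn_gt0.
rewrite -[P (B n)]fineK ?fin_num_measure // lee_fin ler_pdivlMr // mulrC.
have -> : e ^+ 2 * fine (P (B n)) = \int[P]_w (e ^+ 2 * \1_(B n) w).
  rewrite RintegralZl //; last exact: integrable_indic.
  by congr (_ * _); rewrite /Rintegral integral_indic // setIT.
apply: le_trans (_ : \int[P]_w (stopped m e n w ^+ 2) <= _).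
  apply: le_Rintegral => //.
    exact: (integrableZl measurableT (e ^+ 2) (integrable_indic _ (mB n))).
  move=> w _; rewrite indicE; case: (boolP (w \in B n)) => /=; last by rewrite mulr0 sqr_ge0.
  rewrite inE /B /= mulr1 => h.
  rewrite -[stopped _ _ _ _ ^+ 2]real_normK ?num_real //.
  by apply: lerXn2r => //; rewrite nnegrE ?normr_ge0 // ltW.
by apply: le_trans b2 _; apply: ler_wpM2l.
Qed.

Let stopped_sumE m e n w : (forall k, `|stopped m e k w| < e) -> (m <= n)%N ->
  stopped m e n w = M n w - M m w.
Proof.
move=> h /subnKC <-; elim: (n - m)%N => [|j IH].
  rewrite addn0 subrr; have : (m <= m)%N by []; elim: {1 4}m => //= k IH km.
  by rewrite (IH (ltnW km)) leqNgt km /= !mul0r add0r.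
rewrite addnS /= h leq_addr /= mul1r IH /M big_ord_recr /= mulrC addrAC.
by congr (_ - _).
Qed.

Lemma martingale_cauchy : {ae P, forall w, forall e : R, 0 < e ->
  exists m, forall n, (m <= n)%N -> `|M n w - M m w| < e}.
Proof.
pose B m p := \bigcup_n [set w | p.+1%:R^-1 <= `|stopped m p.+1%:R^-1 n w|].
have mB m p : measurable (B m p).
  apply: bigcupT_measurable => n.
  rewrite (_ : [set _ | _] =
    (fun w => p.+1%:R^-1 <= `|stopped m p.+1%:R^-1 n w|) @^-1` [set true]) //.
  rewrite -[X in measurable X]setTI; apply: measurable_fun_ler => //.
  by apply: measurableT_comp => //; apply: (@mf n); exact: measurable_stopped.
have null p : P (\bigcap_m B m p) = 0%E.
  have e0 : 0 < p.+1%:R^-1 ^+ 2 :> R by rewrite exprn_gt0.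
  apply/eqP; rewrite eq_le measure_ge0 andbT; apply/lee_addgt0Pr => x x0; rewrite add0e.
  (* Makes the escape bound at most [x]; [C + 1] stays positive when [C] is 0. *)
  pose r := x * p.+1%:R^-1 ^+ 2 / (C + 1).
  have C1 : 0 < C + 1 by rewrite ltr_wpDl.
  have r0 : 0 < r by rewrite divr_gt0 ?mulr_gt0.
  have [m Hm] := tail_a r0.
  apply: (@le_trans _ _ (P (B m p))).
    apply: le_measure; rewrite ?inE //; first exact: bigcapT_measurable.
    by move=> w; apply.
  apply: le_trans (stopped_escape _ Hm) _; first by rewrite invr_gt0.
  rewrite lee_fin ler_pdivrMr // /r mulrA ler_pdivrMr //.
    rewrite mulrC; apply: ler_wpM2l; last by lra.
  exact/ltW/mulr_gt0.
have : {ae P, forall w, forall p, ~ (\bigcap_m B m p) w}.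
  apply: ae_foralln => p; exists (\bigcap_m B m p); split => //.
  - exact: bigcapT_measurable.
  - exact: null.
  - by move=> w /contrapT.
apply: filterS => w Hw e e0.
have [p pe] : exists p : nat, p.+1%:R^-1 < e.
  by exists (Num.trunc e^-1); rewrite invf_plt ?posrE // truncnS_gt.
have /existsNP[m Hm] : ~ forall m, B m p w by move=> h; apply: (Hw p) => m _.
have small k : `|stopped m p.+1%:R^-1 k w| < p.+1%:R^-1.
  by rewrite ltNge; apply/negP => h; apply: Hm; exists k.
exists m => n mn; rewrite -(stopped_sumE small mn); exact: lt_trans pe.
Qed.

End stopped.

(** * Real sequences *)

Section real_sequences.
Context {R : realType}.
Implicit Types E A D V q r : nat -> R.

(** One notion for two regimes: it says [E] = o([A]) if [A] diverges, and still bounds [E] if [A]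
    stays bounded, so it can be used before it is known which arms are pulled infinitely often. *)
Definition fluctuates_below E A := forall e : R, 0 < e ->
  exists m, forall n, (m <= n)%N -> `|E n - E m| <= e * (1 + A n).

(* Kronecker's lemma, by Abel summation against the partial sums of the weighted series. *)
Lemma kronecker D V : (forall t, 0 <= V t) ->
  (forall e : R, 0 < e -> exists m, forall n, (m <= n)%N ->
    `|\sum_(t < n) D t * (1 + \sum_(s < t.+1) V s)^-1 -
      \sum_(t < m) D t * (1 + \sum_(s < t.+1) V s)^-1| < e) ->
  fluctuates_below (fun n => \sum_(t < n) D t) (fun n => \sum_(t < n) V t).
Proof.
move=> V0 cauchy e e0.
pose A n := \sum_(t < n) V t; pose M n := \sum_(t < n) D t * (1 + A t.+1)^-1.
have A0 n : 0 <= A n by apply: sumr_ge0.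
have e2 : 0 < e / 2 by lra.
have [m Hm] := cauchy _ e2; exists m => n mn.
pose F k := \sum_(t < k) D t - \sum_(t < m) D t.
(* The difference is minus the sum of [V l * (M l - M m)] over m <= l < n, whose terms are at most
   [e / 2 * V l] in absolute value. *)
have : `|F n - (1 + A n) * (M n - M m)| <= e / 2 * (1 + A n).
  rewrite -(subnKC mn); elim: (n - m)%N => [|k IH].
    by rewrite addn0 /F !subrr mulr0 subrr normr0 mulr_ge0 ?addr_ge0 // ltW.
  rewrite addnS; set l := (m + k)%N in IH *.
  have FS : F l.+1 = F l + D l by rewrite /F big_ord_recr /= addrAC.
  have AS : A l.+1 = A l + V l by rewrite /A big_ord_recr.
  have MS : M l.+1 = M l + D l / (1 + A l.+1) by rewrite /M big_ord_recr.
  have Al : 1 + A l.+1 != 0 by rewrite lt0r_neq0 // ltr_wpDr.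
  have -> : F l.+1 - (1 + A l.+1) * (M l.+1 - M m) =
      F l - (1 + A l) * (M l - M m) - V l * (M l - M m).
    rewrite FS MS.
    have -> : (1 + A l.+1) * (M l + D l / (1 + A l.+1) - M m) =
        (1 + A l.+1) * (M l - M m) + D l by field.
    by rewrite AS; ring.
  apply: le_trans (ler_normB _ _) _.
  have -> : e / 2 * (1 + A l.+1) = e / 2 * (1 + A l) + e / 2 * V l by rewrite AS; ring.
  apply: lerD => //.
  rewrite normrM ger0_norm // mulrC ler_wpM2r //.
  by apply/ltW/Hm; exact: leq_addr.
move=> H; have M2 : `|(1 + A n) * (M n - M m)| <= e / 2 * (1 + A n).
  rewrite normrM ger0_norm ?addr_ge0 // mulrC ler_wpM2r ?addr_ge0 //.
  exact/ltW/Hm.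
rewrite -/(F n) -(subrK ((1 + A n) * (M n - M m)) (F n)) -/(A n).
by apply: le_trans (ler_normD _ _) _; lra.
Qed.

Section fluctuates.
Variables E A : nat -> R.
Hypothesis A0 : forall n, 0 <= A n.
Hypothesis EA : fluctuates_below E A.

Lemma fluctuates_below_bounded :
  exists B : R, 0 <= B /\ forall n, `|E n| <= B * (1 + A n).
Proof.
have [m Hm] := EA ltr01.
pose B := 1 + \sum_(i < m.+1) `|E i|.
have B0 : 0 <= B by rewrite addr_ge0 ?sumr_ge0.
have EB i : (i <= m)%N -> `|E i| <= B - 1.
  move=> im; rewrite /B addrAC subrr add0r.
  by rewrite (bigD1 (Ordinal (im : (i < m.+1)%N))) //= lerDl sumr_ge0.
exists B; split=> // n; have An := A0 n.
have [nm|/ltnW mn] := leqP n m.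
  by apply: le_trans (EB _ nm) _; nra.
rewrite -(subrK (E m) (E n)); apply: le_trans (ler_normD _ _) _.
have := Hm n mn; have := EB m (leqnn m) => h1 h2.
have := normr_ge0 (E m) => h3; nra.
Qed.

Lemma fluctuates_below_small (e : R) : A @ \oo --> +oo -> 0 < e ->
  \forall n \near \oo, `|E n| <= e * A n.
Proof.
move=> Aoo e0; have e2 : 0 < e / 2 by lra.
have [m Hm] := EA e2.
near=> n.
rewrite -(subrK (E m) (E n)); apply: le_trans (ler_normD _ _) _.
have h1 : `|E n - E m| <= e / 2 * (1 + A n) by apply: Hm; near: n; exact: nbhs_infty_ge.
have h2 : (`|E m| + e / 2) / (e / 2) <= A n by near: n; move/cvgryPge: Aoo; apply.
move: h2; rewrite ler_pdivrMr // => h2; nra.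
Unshelve. all: by end_near. Qed.

End fluctuates.

(** Multiply 1 - a y <= exp (- a y) by exp (a y), then bound exp (a y) by exp a in the product. The
    crude factor exp a later shifts a logarithm by a constant only. *)
Lemma expR_le_chord (a y : R) : 0 <= a -> 0 <= y <= 1 ->
  expR (a * y) <= 1 + a * expR a * y.
Proof.
move=> a0 /andP[y0 y1].
have h : 1 - a * y <= expR (- (a * y)) by exact: expR_ge1Dx.
have e1 : expR (a * y) * expR (- (a * y)) = 1 by rewrite expRN divff // gt_eqF ?expR_gt0.
have e2 : expR (a * y) <= expR a by rewrite ler_expR ler_piMr.
have := expR_gt0 (a * y) => e3; have := mulr_ge0 a0 y0 => ay; nra.
Qed.

(** * Discrete comparison with the differential equation A' = r exp (- a A) *)

Section growth.
Variables (q r : nat -> R).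
Hypothesis q01 : forall t, 0 <= q t <= 1.
Hypothesis r0 : forall t, 0 <= r t.
Let A n := \sum_(t < n) q t.

Let A_nd : nondecreasing_seq A.
Proof.
apply/nondecreasing_seqP => n; rewrite /A big_ord_recr /= lerDl.
by case/andP: (q01 n).
Qed.

(** By the chord bound each increment of exp (a A) is at most a exp a times [r]. The constant 1
    serves as [r] for neighbours of the best arm; other arms need a genuine sequence. *)
Lemma growth_upper (a : R) : 0 < a ->
  (\forall t \near \oo, q t * expR (a * A t) <= r t) ->
  exists C : R, forall T, expR (a * A T) <= C + a * expR a * \sum_(t < T) r t.
Proof.
move=> a0 [m _ Hm]; exists (expR (a * A m)) => T.
have c0 : 0 <= a * expR a by rewrite mulr_ge0 ?expR_ge0 // ltW.
have [Tm|/ltnW mT] := leqP T m.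
  apply: ler_wpDr; first by rewrite mulr_ge0 ?sumr_ge0.
  by rewrite ler_expR; apply: ler_wpM2l; [exact: ltW|exact: A_nd].
rewrite -(subnKC mT); elim: (T - m)%N => [|k IH].
  by rewrite addn0 lerDl mulr_ge0 ?sumr_ge0.
rewrite addnS; set l := (m + k)%N in IH *.
rewrite /A !big_ord_recr /= -/(A l) !mulrDr expRD.
have := Hm l (leq_addr _ _) => /= h.
have h2 := expR_le_chord (ltW a0) (q01 l).
apply: le_trans (_ : expR (a * A l) * (1 + a * expR a * q l) <= _).
  by rewrite ler_wpM2l ?expR_ge0.
rewrite mulrDr mulr1 addrA; apply: lerD => //.
by rewrite mulrCA ler_wpM2l // mulrC.
Qed.

(** The reverse comparison, from 1 + b y <= exp (b y). In both bounds [C] accounts for the times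
    before the hypothesis takes effect. *)
Lemma growth_lower (b : R) : 0 < b ->
  (\forall t \near \oo, r t <= q t * expR (b * A t)) ->
  exists C : R, forall T, b * (\sum_(t < T) r t) - C <= expR (b * A T).
Proof.
move=> b0 [m _ Hm]; exists (b * \sum_(t < m) r t) => T.
have [Tm|/ltnW mT] := leqP T m.
  apply: le_trans (expR_ge0 _); rewrite subr_le0; apply: ler_wpM2l; first exact: ltW.
  rewrite -(subnKC Tm) big_split_ord /= lerDl sumr_ge0 //.
rewrite -(subnKC mT); elim: (T - m)%N => [|k IH].
  by rewrite addn0 subrr expR_ge0.
rewrite addnS; set l := (m + k)%N in IH *.
rewrite /A !big_ord_recr /= -/(A l) !mulrDr expRD.
have := Hm l (leq_addr _ _) => /= h.
apply: le_trans (_ : expR (b * A l) * (1 + b * q l) <= _); last first.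
  by rewrite ler_wpM2l ?expR_ge0 // expR_ge1Dx.
rewrite mulrDr mulr1 addrAC; apply: lerD => //.
by rewrite mulrCA; apply: ler_wpM2l; [exact: ltW|rewrite mulrC].
Qed.

End growth.

Lemma cvg_ln_nat_pinfty : (fun T => ln (T%:R : R)) @ \oo --> +oo.
Proof.
apply/cvgryPge => c; near=> T.
have h : expR c <= T%:R by near: T; exact: nbhs_infty_ger.
by rewrite -[c]expRK ler_ln ?posrE ?expR_gt0 // (lt_le_trans (expR_gt0 c)).
Unshelve. all: by end_near. Qed.

Lemma cvg_div_ln (A : nat -> R) (c : R) : 0 < c ->
  (forall a, 0 < a < c -> exists C, \forall T \near \oo, a * A T <= ln T%:R + C) ->
  (forall b, c < b -> exists C, \forall T \near \oo, ln T%:R - C <= b * A T) ->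
  (fun T => A T / ln T%:R) @ \oo --> c^-1.
Proof.
move=> c0 up low; apply/cvgrPdist_le => e e0.
have ec : 0 < e * c by rewrite mulr_gt0.
have c1 : 0 < 1 + e * c / 2 by lra.
have cc : c * c^-1 = 1 by rewrite divff // gt_eqF.
have ci : 0 < c^-1 by rewrite invr_gt0.
(* The inverse of this rate is 1 / c + e / 2; that of the rate used for the lower bound is at least
   1 / c - e / 2. The remaining e / 2 absorbs the additive constants once ln T is large. *)
have [|C1 H1] := up (c / (1 + e * c / 2)).
  by rewrite divr_gt0 //= ltr_pdivrMr //; nra.
have [|C2 H2] := low (c * (1 + e * c / 2)); first by nra.
near=> T.
have L1 : 1 <= ln (T%:R : R).
  by near: T; have /cvgryPge := cvg_ln_nat_pinfty; apply.
have L2 : (C1 * (c^-1 + e / 2)) / (e / 2) <= ln (T%:R : R).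
  by near: T; have /cvgryPge := cvg_ln_nat_pinfty; apply.
have L3 : (C2 * c^-1) / (e / 2) <= ln (T%:R : R).
  by near: T; have /cvgryPge := cvg_ln_nat_pinfty; apply.
have U : c / (1 + e * c / 2) * A T <= ln T%:R + C1 by near: T; exact: H1.
have W : ln T%:R - C2 <= c * (1 + e * c / 2) * A T by near: T; exact: H2.
set L := ln _ in L1 L2 L3 U W *.
have L0 : 0 < L by lra.
move: L2 L3; rewrite !ler_pdivrMr; try lra; move=> L2 L3.
rewrite distrC ler_norml; apply/andP; split.
- rewrite lerBrDl -(ler_pM2r L0) divfK ?gt_eqF //.
  have W' : c^-1 * (L - C2) <= (1 + e * c / 2) * A T.
    by rewrite mulrC ler_pdivrMr //; nra.
  have [Ac|Ac] := leP (A T) (c^-1 * L); last by nra.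
  have : e * c / 2 * A T <= e * c / 2 * (c^-1 * L) by rewrite ler_wpM2l //; lra.
  have -> : e * c / 2 * (c^-1 * L) = e / 2 * L by rewrite -[in RHS](mulr1 e) -cc; ring.
  by nra.
- rewrite lerBlDl -(ler_pM2r L0) divfK ?gt_eqF //.
  have U' : A T <= (L + C1) * (c^-1 + e / 2).
    have -> : c^-1 + e / 2 = (1 + e * c / 2) / c by field; rewrite gt_eqF.
    rewrite mulrA ler_pdivlMr //.
    have := U; rewrite mulrAC ler_pdivrMr // => {}U.
    by nra.
  by nra.
Unshelve. all: by end_near. Qed.

Lemma nondecreasing_bounded_or_pinfty (u : nat -> R) : nondecreasing_seq u ->
  (exists B, forall t, u t <= B) \/ u @ \oo --> +oo.
Proof.
move=> und; have [h|h] := pselect (exists B, forall t, u t <= B); [by left|right].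
apply/cvgryPge => B; have [m Bm] : exists m, B <= u m.
  apply: contrapT => H; apply: h; exists B => t; rewrite leNgt; apply/negP => Bt.
  by apply: H; exists t; exact: ltW.
by exists m => // t mt; apply: le_trans Bm _; exact: und.
Qed.

(** The factor 2 absorbs the initial segment, where [u] is not controlled. *)
Lemma sum_near_le (u v : nat -> R) (e : R) : (forall t, 0 <= v t) -> 0 < e ->
  (fun T => \sum_(t < T) v t) @ \oo --> +oo ->
  (\forall t \near \oo, u t <= e * v t) ->
  \forall T \near \oo, \sum_(t < T) u t <= 2 * e * \sum_(t < T) v t.
Proof.
move=> v0 e0 /cvgryPge voo [m _ Hm]; near=> T.
have mT : (m <= T)%N by near: T; exact: nbhs_infty_ge.
have h : (\sum_(t < m) u t) / e <= \sum_(t < T) v t by near: T; apply: voo.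
have : \sum_(t < T) u t <= \sum_(t < m) u t + e * \sum_(t < T) v t.
  rewrite -(subnKC mT) !big_split_ord /= lerD2l mulrDr.
  apply: ler_wpDl; first by rewrite mulr_ge0 ?sumr_ge0 // ltW.
  by rewrite mulr_sumr; apply: ler_sum => t _; apply: Hm; exact: leq_addr.
move: h; rewrite ler_pdivrMr // => ? ?; lra.
Unshelve. all: by end_near. Qed.

Lemma cvg_finite_sum (I : Type) (r : seq I) (Q : pred I)
  (f : I -> nat -> R) (l : I -> R) : (forall i, Q i -> f i @ \oo --> l i) ->
  (fun T => \sum_(i <- r | Q i) f i T) @ \oo --> \sum_(i <- r | Q i) l i.
Proof.
move=> fl; elim: r => [|i r IH].
  by rewrite big_nil; under eq_fun do rewrite big_nil; exact: cvg_cst.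
rewrite big_cons; under eq_fun do rewrite big_cons.
by case: ifP => // Qi; apply: cvgD => //; exact: fl.
Qed.

End real_sequences.

(** * Geometry of the profile regions *)

(* Geodesic betweenness in the complete graph ([complete = true]) or in the path graph on the
   arms: [btw complete k i p] says that i lies on the geodesic from k to p. For R^K and for the
   unimodal set alike, the profiles maximal at p are those increasing along geodesics to p. *)
Definition btw (complete : bool) {K : nat} (k i p : 'I_K) : bool :=
  if complete then (i == k) || (i == p)
  else ((k <= i <= p) || (p <= i <= k))%N.

Definition adjacent (complete : bool) {K : nat} (j p : 'I_K) : bool :=
  if complete then j != p else (j.+1 == p :> nat) || (p.+1 == j :> nat).

Section betweenness.
Variables (c : bool) (K : nat).
Implicit Types i j k l p q : 'I_K.

Lemma btw_end k p : btw c k p p.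
Proof. by case: c; rewrite /btw ?eqxx ?orbT //; lia. Qed.

Lemma btw_start k p : btw c k k p.
Proof. by case: c; rewrite /btw ?eqxx //; lia. Qed.

Lemma btw_sym k i p : btw c k i p = btw c p i k.
Proof. by case: c; rewrite /btw orbC // [in RHS]andbC [X in _ || X]andbC. Qed.

Lemma btw_same p i : btw c p i p -> i = p.
Proof.
case: c; rewrite /btw orbb; first by move/eqP.
by move=> h; apply/val_inj => /=; lia.
Qed.

Lemma btw_antisym i j p : btw c j i p -> btw c i j p -> i = j.
Proof.
case: c; rewrite /btw.
  by move=> /orP[/eqP|/eqP] // -> /orP[/eqP|/eqP].
by move=> h1 h2; apply/val_inj => /=; lia.
Qed.

(** When the mode moves from [l] to a neighbour [q], the constraints pointing to an arm other than
    [q] were already there; hence changing the value at [q] is enough. *)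
Lemma btw_adjacent q l k i : adjacent c q l -> btw c k i q -> i != q -> btw c k i l.
Proof.
case: c; rewrite /btw /adjacent.
  by move=> _ /orP[/eqP -> _|/eqP ->]; rewrite eqxx.
by rewrite -(inj_eq val_inj) /=; lia.
Qed.

(** On the path, such a [k] lies beyond [p] as seen from [j]; in the complete graph it is any arm
    other than [j] and [p]. A profile with mode [j] is already ordered there. *)
Lemma btw_other_side j p k i : ~~ btw c k j p -> ~~ btw c j k p -> btw c k i p -> i != p ->
  [/\ ~~ btw c i j p, ~~ btw c j i p & btw c k i j].
Proof.
case: c; rewrite /btw.
  by move=> h1 h2 /orP[/eqP ->|/eqP ->]; rewrite ?eqxx // => _; split.
rewrite -(inj_eq val_inj) /= => h1 h2 h3 h4; split; lia.
Qed.

Lemma btw_behind j p k i : btw c k j p -> btw c k i p -> i != p ->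
  (btw c i j p /\ btw c k i j) \/ (btw c j i p /\ i != j).
Proof.
case: c; rewrite /btw.
  move=> h1 /orP[/eqP ->|/eqP ->]; rewrite ?eqxx // => _.
  by left; split => //.
rewrite -!(inj_eq val_inj) /= => h1 h2 h3.
have [h|h] := boolP (((i <= j) && (j <= p) || (p <= j) && (j <= i))%N); [left|right]; split; lia.
Qed.

Lemma btw_trans j p k i : btw c j k p -> k != j -> btw c k i p -> btw c j i p /\ (i != j).
Proof.
case: c; rewrite /btw.
  move=> /orP[/eqP ->|/eqP ->]; rewrite ?eqxx // => kj.
  by rewrite orbb => /eqP ->; rewrite eqxx orbT.
rewrite -!(inj_eq val_inj) /= => h1 h2 h3; split; lia.
Qed.

Lemma btw_nonadjacent j p : j != p -> ~~ adjacent c j p ->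
  exists n, [/\ n != p, n != j, btw c j n p & adjacent c n p].
Proof.
case: c; rewrite /btw /adjacent; first by move=> ->.
rewrite -(inj_eq val_inj) /= => jp nadj.
have [h|h] := ltnP j p.
  have np : (p.-1 < K)%N by have := ltn_ord p; lia.
  exists (Ordinal np); rewrite -!(inj_eq val_inj) /=; split; lia.
have np : (p.+1 < K)%N by have := ltn_ord j; lia.
exists (Ordinal np); rewrite -!(inj_eq val_inj) /=; split; lia.
Qed.

Lemma adjacent_connected (I : pred 'I_K) l : I l ->
  (forall i j, I i -> adjacent c j i -> I j) -> forall j, I j.
Proof.
move=> Il step j; have [n] := ubnP `|(j : nat)%:Z - (l : nat)%:Z|%N.
elim: n j => // n IH j dist.
have [-> //|jl] := eqVneq j l.
case: (boolP c) => hc.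
  by apply: (step l) => //; rewrite /adjacent hc.
have hcf : c = false by exact/negbTE.
move: jl; rewrite -(inj_eq val_inj) /= => jl.
have [h|h] := ltnP j l.
  have np : (j.+1 < K)%N by have := ltn_ord l; lia.
  apply: (step (Ordinal np)); last by rewrite /adjacent hcf /= eqxx.
  by apply: IH => /=; lia.
have np : (j.-1 < K)%N by have := ltn_ord j; lia.
apply: (step (Ordinal np)); last by rewrite /adjacent hcf /=; lia.
by apply: IH => /=; lia.
Qed.

(** Induction on the number of arms on the geodesic to [p], which by [btw_trans] drops strictly for
    an arm closer to [p]. *)
Lemma btw_ind p (Q : 'I_K -> Prop) :
  (forall j, (forall i, btw c j i p -> i != j -> Q i) -> Q j) -> forall j, Q j.
Proof.
move=> step j; have [n] := ubnP #|[pred i | btw c j i p]|.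
elim: n j => // n IH j /ltnSE cardj; apply: step => i jip ij; apply: IH.
apply: leq_trans cardj; apply: proper_card; apply/properP; split.
  apply/fintype.subsetP => k; rewrite !inE /= => ikp.
  by have [] := btw_trans jip ij ikp.
exists j; first by rewrite inE /= btw_start.
rewrite inE; apply/negP => h.
by have [_] := btw_trans jip ij h; rewrite eqxx.
Qed.

End betweenness.

(** * Moving the maximum of a profile, and what it costs *)

Section regions.
Context {R : realType} {K : nat}.
Variable c : bool.
Implicit Types (v : 'I_K -> R) (i j k l p q : 'I_K).

Definition mode_region p : set ('I_K -> R) :=
  [set v | forall k i, btw c k i p -> v k <= v i].

Variables (N h : 'I_K -> R).
Hypothesis N0 : forall k, 0 <= N k.

(** The change of the negative log-likelihood when [N] and [h] are the pull counts and the empirical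
    means: the scatter around the means does not depend on the profile and cancels. *)
Definition cost_change v v' : R :=
  \sum_k N k / 2 * ((v' k - h k) ^+ 2 - (v k - h k) ^+ 2).

(** Capping at a level above the empirical mean can only improve the fit. *)
Let term_min_le k (x s : R) : h k <= s ->
  N k / 2 * ((Num.min x s - h k) ^+ 2 - (x - h k) ^+ 2) <= 0.
Proof.
move=> hs; apply: mulr_ge0_le0; first by rewrite divr_ge0.
by case: (leP x s) => xs; [rewrite subrr|nra].
Qed.

(** Lift [q] to the value at [l], then cap everything at [M]. Off [q] capping costs nothing. At [q]
    the value only rises before the cap: below [h q] this improves the fit, and above it the cap
    limits the cost, uniformly in [v]. *)
Lemma shift_mode_adjacent q l (M : R) v : adjacent c q l -> (forall k, h k <= M) ->
  mode_region l v -> exists2 v', mode_region q v' &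
    cost_change v v' <= N q / 2 * (M - h q) ^+ 2.
Proof.
move=> ql hM vl; pose v' k := Num.min (v (if k == q then l else k)) M.
exists v'.
  move=> k i kiq; rewrite /v'; have [iq|iq] := eqVneq i q.
    have : v (if k == q then l else k) <= v l by apply: vl; exact: btw_end.
    by move=> le1; rewrite le_min !ge_min le1 lexx !orbT.
  have kq : k != q by apply: contraNneq iq => kq; move: kiq; rewrite kq => /btw_same/eqP.
  rewrite (negbTE kq).
  have : v k <= v i by apply: vl; exact: btw_adjacent kiq iq.
  by move=> le1; rewrite le_min !ge_min le1 lexx !orbT.
rewrite /cost_change (bigD1 q) //= -[leRHS]addr0; apply: lerD; last first.
  apply: sumr_le0 => k kq; rewrite /v' (negbTE kq); exact: term_min_le.
apply: ler_wpM2l; first by rewrite divr_ge0.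
rewrite /v' eqxx; have vql : v q <= v l by apply: vl; exact: btw_end.
have := hM q; set x := v q in vql *; set y := v l in vql *; set z := h q => zM.
have x2 := sqr_ge0 (x - z); have M2 := sqr_ge0 (M - z).
case: (leP y M) => yM; last by lra.
have [zy|yz] := leP z y.
  have : (y - z) ^+ 2 <= (M - z) ^+ 2 by nra.
  lra.
have : (y - z) ^+ 2 <= (x - z) ^+ 2 by nra.
lra.
Qed.

Variables (mu : 'I_K -> R) (p : 'I_K) (eta : R).
Hypothesis mu_p : mode_region p mu.
Hypothesis eta0 : 0 < eta.
Hypothesis h_eta : forall k, `|h k - mu k| <= eta.
Hypothesis sep : forall i, i != p -> mu i + 5 * eta <= mu p.

(** Saving per pull of [i]: the old value is at least [mu p - 2 * eta] and the empirical mean at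
    most [mu i + eta], a misfit of at least the gap minus [3 * eta]; the new value [mu i + eta] has
    misfit at most [2 * eta]. *)
Definition gain i : R := ((mu p - mu i - 3 * eta) ^+ 2 - (2 * eta) ^+ 2) / 2.

(* The two arguments of the minimum: if v p is close to mu p, then v lies above mu by almost the
   full gap along the whole geodesic from j to p; otherwise p itself is badly fitted by v. *)
Lemma shift_mode_to_best j v : j != p -> mode_region j v ->
  exists2 v', mode_region p v' &
    cost_change v v' <= - Num.min (\sum_(i | btw c j i p && (i != p)) N i * gain i)
      (eta ^+ 2 / 2 * N p - 2 * eta ^+ 2 * \sum_(i | [&& btw c j i p, i != p & i != j]) N i).
Proof.
move=> jp vj; have e0 := eta0.
have hlo k : mu k - eta <= h k by have := h_eta k; rewrite ler_norml => /andP[? ?]; lra.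
have hhi k : h k <= mu k + eta by have := h_eta k; rewrite ler_norml => /andP[? ?]; lra.
(* In order: [p] is raised; [j] and the arms beyond it are capped; the arms strictly between [j] and
   [p] are reset near their means; the others are capped. Each cap lies above the empirical mean it
   acts on, and all values off [p] end at most at [mu p - eta]. *)
pose v' i := if i == p then Num.max (v p) (mu p - eta)
  else if btw c i j p then Num.min (v i) (mu j + eta)
  else if btw c j i p then mu i + eta
  else Num.min (v i) (mu p - eta).
have v'p i : i != p -> v' i <= mu p - eta.
  move=> ip; rewrite /v' (negbTE ip); have := sep ip; have := sep jp => ? ?.
  by case: ifP => _; [|case: ifP => _]; rewrite ?ge_min;
    [apply/orP; right; lra|lra|rewrite lexx orbT].
exists v'.
  move=> k i kip; have [ip|ip] := eqVneq i p.
    have [->|kp] := eqVneq k p; first by rewrite ip.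
    by apply: le_trans (v'p _ kp) _; rewrite /v' ip eqxx le_max lexx orbT.
  have kp : k != p by apply: contraNneq ip => kp; move: kip; rewrite kp => /btw_same/eqP.
  rewrite /v' (negbTE kp) (negbTE ip).
  have [kjp|kjp] := boolP (btw c k j p).
    have [[ijp kij]|[jip ij]] := btw_behind kjp kip ip.
      have vki := vj _ _ kij.
      by rewrite ijp le_min !ge_min vki lexx !orbT.
    have -> : btw c i j p = false.
      by apply/negP => ijp; move: ij; rewrite (btw_antisym jip ijp) eqxx.
    rewrite jip ge_min; apply/orP; right.
    by rewrite lerD2r; apply: mu_p.
  have [jkp|jkp] := boolP (btw c j k p).
    have kj : k != j by apply: contraNneq kjp => ->; exact: btw_start.
    have [jip ij] := btw_trans jkp kj kip.
    have -> : btw c i j p = false.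
      by apply/negP => ijp; move: ij; rewrite (btw_antisym jip ijp) eqxx.
    by rewrite jip lerD2r; apply: mu_p.
  have [/negbTE -> /negbTE -> kij] := btw_other_side kjp jkp kip ip.
  have vki := vj _ _ kij.
  by rewrite le_min !ge_min vki lexx !orbT.
have tp : N p / 2 * ((v' p - h p) ^+ 2 - (v p - h p) ^+ 2) <= 0.
  apply: mulr_ge0_le0; first by rewrite divr_ge0.
  rewrite /v' eqxx; have := hlo p.
  by case: (leP (v p) (mu p - eta)) => ? ?; [nra|rewrite subrr].
have tout i : i != p -> (i == j) || ~~ btw c j i p ->
    N i / 2 * ((v' i - h i) ^+ 2 - (v i - h i) ^+ 2) <= 0.
  move=> ip out; rewrite /v' (negbTE ip); have [ijp|ijp] := boolP (btw c i j p).
    by apply: term_min_le; apply: le_trans (hhi i) _; rewrite lerD2r; apply: mu_p.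
  move: out; case: eqVneq => [ij|_ /= /negbTE ->]; first by move: ijp; rewrite ij btw_start.
  apply: term_min_le; apply: le_trans (hhi i) _; have := sep ip; lra.
have [A|B] := leP (mu p - 2 * eta) (v p).
  apply: (@le_trans _ _ (- \sum_(i | btw c j i p && (i != p)) N i * gain i)); last first.
    by rewrite lerN2 ge_min lexx.
  rewrite /cost_change (bigD1 p) //= -[leRHS]add0r; apply: lerD => //.
  rewrite (bigID (btw c j ^~ p)) /= -[leRHS]addr0; apply: lerD; last first.
    by apply: sumr_le0 => i /andP[ip jip]; apply: tout => //; rewrite jip orbT.
  rewrite -sumrN; under eq_bigl do rewrite andbC.
  apply: ler_sum => i /andP[jip ip].
  have v'i : v' i = mu i + eta.
    rewrite /v' (negbTE ip) jip; have [ijp|//] := boolP (btw c i j p).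
    (* Here [i] is [j], and its cap is attained: [v j] is at least [v p], hence at least
       [mu p - 2 * eta], which exceeds [mu j + eta] by [sep]. *)
    have -> := btw_antisym jip ijp.
    rewrite minElt; case: ltP => // vje.
    have : v p <= v j by apply: vj; exact: btw_end.
    have := sep jp; lra.
  have vpi : v p <= v i by apply: vj; rewrite btw_sym.
  rewrite v'i /gain -[leRHS]mulrN mulrAC -mulrA; apply: ler_wpM2l => //.
  have := hlo i; have := hhi i; have := sep ip.
  set x := v i in vpi *; set y := v p in vpi A *; set z := h i => ? ? ?.
  have : (mu i + eta - z) ^+ 2 <= (2 * eta) ^+ 2 by nra.
  have : (mu p - mu i - 3 * eta) ^+ 2 <= (x - z) ^+ 2 by nra.
  lra.
(* Now [v p] is more than [eta] below its new value, itself below [h p]: this saves [eta ^+ 2 / 2]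
   per pull of [p]. Each reset arm strictly between costs at most half the square of [2 * eta] per
   pull. *)
apply: (@le_trans _ _ (- (eta ^+ 2 / 2 * N p -
    2 * eta ^+ 2 * \sum_(i | [&& btw c j i p, i != p & i != j]) N i))); last first.
  by rewrite lerN2 ge_min lexx orbT.
rewrite /cost_change (bigD1 p) //= opprB addrC mulr_sumr; apply: lerD.
  rewrite (bigID (fun i => btw c j i p && (i != j))) /= -[leRHS]addr0; apply: lerD; last first.
    apply: sumr_le0 => i /andP[ip out]; apply: tout => //.
    by move: out; rewrite negb_and negbK orbC.
  rewrite (eq_bigl (fun i => [&& btw c j i p, i != p & i != j])); last first.
    by move=> i; rewrite andbCA.
  apply: ler_sum => i /and3P[jip ip ij].
  have v'i : v' i = mu i + eta.
    rewrite /v' (negbTE ip) jip; have [ijp|//] := boolP (btw c i j p).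
    by move: ij; rewrite (btw_antisym jip ijp) eqxx.
  rewrite v'i; have := hlo i; have := hhi i; set z := h i => ? ?.
  have : (mu i + eta - z) ^+ 2 <= (2 * eta) ^+ 2 by nra.
  have := sqr_ge0 (v i - z); have := N0 i; nra.
have v'pE : v' p = mu p - eta by rewrite /v' eqxx; apply/max_idPr; lra.
rewrite v'pE; have := hlo p; set x := v p in B *; set z := h p => zlo.
have : (mu p - eta - z) ^+ 2 - (x - z) ^+ 2 <= - eta ^+ 2 by nra.
have := N0 p; nra.
Qed.
End regions.

(** * Posterior ratios *)

Section posterior_ratio.
Context {R : realType} {K : nat}.
Implicit Types (v : 'I_K -> R) (D : @data R K) (Theta : set ('I_K -> R)).

Definition cost D v : R := \sum_(o <- D) (v o.1 - o.2) ^+ 2 / 2.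

Lemma cost_ge0 D v : 0 <= cost D v.
Proof. by apply: sumr_ge0 => o _; rewrite divr_ge0 ?sqr_ge0. Qed.

Definition likelihood_max : R := (Num.sqrt (2 * pi))^-1.

Lemma likelihood_max_gt0 : 0 < likelihood_max.
Proof. by rewrite invr_gt0 sqrtr_gt0 mulr_gt0 ?pi_gt0. Qed.

Lemma likelihoodE v D :
  likelihood 1 v D = likelihood_max ^+ size D * expR (- cost D v).
Proof.
rewrite /likelihood /cost; elim: D => [|o D IH].
  by rewrite !big_nil oppr0 expR0 mulr1.
rewrite !big_cons IH /= [_ ^+ (size D).+1]exprS opprD expRD /likelihood_max mulr1 expr1n mulr1.
by ring.
Qed.

Lemma likelihood_gt0 v D : 0 < likelihood 1 v D.
Proof. by rewrite likelihoodE mulr_gt0 ?expR_gt0 ?exprn_gt0 ?likelihood_max_gt0. Qed.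

Lemma likelihood_le v D : likelihood 1 v D <= likelihood_max ^+ size D.
Proof.
rewrite likelihoodE ler_piMr ?exprn_ge0 ?(ltW likelihood_max_gt0) //.
by rewrite -expR0 ler_expR oppr_le0 cost_ge0.
Qed.

Variable Theta : set ('I_K -> R).
Hypothesis Theta0 : forall j, argmax_region Theta j !=set0.

Let ubound j D : has_ubound [set likelihood 1 v D | v in argmax_region Theta j].
Proof. by exists (likelihood_max ^+ size D) => _ [v _ <-]; exact: likelihood_le. Qed.

Lemma le_profile_likelihood j v D : argmax_region Theta j v ->
  likelihood 1 v D <= profile_likelihood 1 Theta j D.
Proof. by move=> jv; apply: ub_le_sup; [exact: ubound|exists v]. Qed.

Lemma profile_likelihood_gt0 j D : 0 < profile_likelihood 1 Theta j D.
Proof.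
have [v jv] := Theta0 j.
exact: lt_le_trans (likelihood_gt0 v D) (le_profile_likelihood D jv).
Qed.

(** Profiles are moved one at a time, so the suprema are compared without choosing maximisers. *)
Lemma profile_likelihood_le l q (a : R) D :
  (forall v, argmax_region Theta l v ->
    exists2 v', argmax_region Theta q v' & cost D v' <= cost D v + a) ->
  profile_likelihood 1 Theta l D <= expR a * profile_likelihood 1 Theta q D.
Proof.
move=> H; apply: ge_sup.
  by have [v lv] := Theta0 l; exists (likelihood 1 v D); exists v.
move=> _ [v lv <-]; have [v' qv' le] := H v lv.
apply: le_trans (_ : expR a * likelihood 1 v' D <= _); last first.
  by rewrite ler_wpM2l ?expR_ge0 // le_profile_likelihood.
rewrite !likelihoodE mulrCA; apply: ler_wpM2l.
  by rewrite exprn_ge0 // ltW // likelihood_max_gt0.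
by rewrite -expRD ler_expR; lra.
Qed.

Lemma sum_profile_likelihood_gt0 (j : 'I_K) D :
  0 < \sum_(k < K) profile_likelihood 1 Theta k D * @uniform_prior R K k.
Proof.
rewrite (bigD1 j) //=; apply: ltr_wpDr.
  by apply: sumr_ge0 => k _; rewrite mulr_ge0 ?invr_ge0 // ltW // profile_likelihood_gt0.
rewrite mulr_gt0 ?profile_likelihood_gt0 // invr_gt0 ltr0n.
exact: leq_ltn_trans (ltn_ord j).
Qed.

Lemma posterior_gt0 j D : 0 < posterior 1 Theta uniform_prior D j.
Proof.
rewrite divr_gt0 ?sum_profile_likelihood_gt0 // mulr_gt0 ?profile_likelihood_gt0 //.
by rewrite invr_gt0 ltr0n; exact: leq_ltn_trans (ltn_ord j).
Qed.

Lemma sum_posterior (j : 'I_K) D : \sum_(k < K) posterior 1 Theta uniform_prior D k = 1.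
Proof. by rewrite -mulr_suml divff // gt_eqF // sum_profile_likelihood_gt0. Qed.

Lemma posterior_le1 j D : posterior 1 Theta uniform_prior D j <= 1.
Proof.
rewrite -[leRHS](sum_posterior j D) (bigD1 j) //= lerDl sumr_ge0 // => k _.
exact/ltW/posterior_gt0.
Qed.

(** The normaliser and the uniform prior cancel in the ratio. A negative [a] gives decay, a positive
    one a lower bound on the posterior of [q]. *)
Lemma posterior_le l q (a : R) D :
  (forall v, argmax_region Theta l v ->
    exists2 v', argmax_region Theta q v' & cost D v' <= cost D v + a) ->
  posterior 1 Theta uniform_prior D l <= expR a * posterior 1 Theta uniform_prior D q.
Proof.
move=> /profile_likelihood_le H.
rewrite /posterior mulrA mulrA; apply: ler_wpM2r.
  by rewrite invr_ge0 ltW // sum_profile_likelihood_gt0.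
by apply: ler_wpM2r => //; rewrite invr_ge0.
Qed.

End posterior_ratio.

(** * Pull counts and empirical means as sufficient statistics *)

Section trajectory_statistics.
Context {R : realType} {K : nat}.
Variables (x : nat -> 'I_K) (phi : nat -> R) (mu : 'I_K -> R).
Implicit Types (j k : 'I_K) (t : nat) (v : 'I_K -> R).

Definition observations t : @data R K := [seq (x i, phi i) | i <- iota 0 t].

Definition pulls j t : R := \sum_(i < t) (x i == j)%:R.

Definition noise j t : R := \sum_(i < t) (x i == j)%:R * (phi i - mu j).

(* Equal to mu j, rather than to a junk 0, before the first pull of j. *)
Definition estimate t j : R := mu j + noise j t / pulls j t.

Lemma pulls_ge0 j t : 0 <= pulls j t.
Proof. by apply: sumr_ge0. Qed.

Lemma pulls_nd j : nondecreasing_seq (pulls j).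
Proof. by apply/nondecreasing_seqP => t; rewrite /pulls big_ord_recr /= lerDl. Qed.

Lemma noiseE j t : noise j t = pulls j t * (estimate t j - mu j).
Proof.
rewrite /estimate addrAC subrr add0r mulrCA.
have [n0|n0] := eqVneq (pulls j t) 0; last by rewrite divff // mulr1.
rewrite n0 mul0r mulr0; apply: big1 => i _.
have /eqP := n0; rewrite psumr_eq0 // => /allP /(_ i); rewrite mem_index_enum => /(_ isT).
by move=> /eqP ->; rewrite mul0r.
Qed.

Lemma cost_observationsE t v :
  cost (observations t) v = \sum_(i < t) (v (x i) - phi i) ^+ 2 / 2.
Proof.
rewrite /cost /observations big_map.
have -> : iota 0 t = index_iota 0 t by rewrite /index_iota subn0.
by rewrite big_mkord.
Qed.

(** The feedback enters a difference of two squares linearly, so only pull counts and noise sums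
    survive. *)
Lemma cost_changeE t v v' : cost (observations t) v' =
  cost (observations t) v + cost_change (pulls ^~ t) (estimate t) v v'.
Proof.
have -> : cost_change (pulls ^~ t) (estimate t) v v' =
    \sum_k (pulls k t / 2 * ((v' k - mu k) ^+ 2 - (v k - mu k) ^+ 2) - noise k t * (v' k - v k)).
  by apply: eq_bigr => k _; rewrite noiseE; field.
rewrite !cost_observationsE.
under [X in _ + X]eq_bigr => k _.
  rewrite /pulls /noise !mulr_suml -sumrB.
  over.
rewrite exchange_big /= -big_split /=; apply: eq_bigr => i _.
rewrite (bigD1 (x i)) //= eqxx big1 ?addr0; last first.
  by move=> k; rewrite eq_sym => /negbTE ->; rewrite !mul0r subrr.
rewrite /= mulr1n; by field.
Qed.

Lemma sum_pulls t : \sum_k pulls k t = t%:R.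
Proof.
rewrite exchange_big /= (eq_bigr (fun=> 1)); last first.
  move=> i _; rewrite (bigD1 (x i)) //= eqxx big1 ?addr0 // => k.
  by rewrite eq_sym => /negbTE ->.
by rewrite sumr_const card_ord.
Qed.

End trajectory_statistics.

(** * Pathwise asymptotics of the numbers of pulls *)

Section asymptotics.
Context {R : realType} {K : nat}.
Variables (x : nat -> 'I_K) (phi : nat -> R) (mu : 'I_K -> R) (p : 'I_K).
Variables (Theta : set ('I_K -> R)) (c : bool).
Implicit Types (j k l : 'I_K) (t : nat).

Let q j t : R := posterior 1 Theta uniform_prior (observations x phi t) j.
Let A j T : R := \sum_(t < T) q j t.
Let N j t : R := pulls x j t.
Let est t j : R := estimate x phi mu t j.

Hypothesis regionE : forall j, argmax_region Theta j = mode_region c j.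
Hypothesis mu_p : mode_region c p mu.
Hypothesis p_best : forall j, j != p -> mu j < mu p.
Hypothesis noise_small : forall j, fluctuates_below (noise x phi mu j) (N j).
Hypothesis pulls_near : forall j, fluctuates_below (fun t => N j t - A j t) (A j).

Let Theta0 j : argmax_region Theta j !=set0.
Proof. by rewrite regionE; exists (fun=> 0) => k i _. Qed.

Let q_gt0 j t : 0 < q j t.
Proof. exact: posterior_gt0. Qed.

Let q_le1 j t : q j t <= 1.
Proof. exact: posterior_le1. Qed.

Let q01 j t : 0 <= q j t <= 1.
Proof. by rewrite ltW //= q_le1. Qed.

Let A_ge0 j t : 0 <= A j t.
Proof. by apply: sumr_ge0 => s _; rewrite ltW. Qed.

Let N_ge0 j t : 0 <= N j t.
Proof. exact: pulls_ge0. Qed.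

Let posterior_adjacent j l (M : R) t : adjacent c j l -> (forall k, est t k <= M) ->
  q l t <= expR (N j t / 2 * (M - est t j) ^+ 2) * q j t.
Proof.
move=> jl hM; apply: posterior_le => // v; rewrite !regionE => lv.
have [v' jv' le] := shift_mode_adjacent (fun k => N_ge0 k t) jl hM lv.
by exists v' => //; rewrite (cost_changeE _ _ mu t v v') lerD2l.
Qed.

Let posterior_best j t (eta : R) : j != p -> 0 < eta ->
  (forall k, `|est t k - mu k| <= eta) -> (forall i, i != p -> mu i + 5 * eta <= mu p) ->
  q j t <= expR (- Num.min (\sum_(i | btw c j i p && (i != p)) N i t * gain mu p eta i)
      (eta ^+ 2 / 2 * N p t - 2 * eta ^+ 2 *
       \sum_(i | [&& btw c j i p, i != p & i != j]) N i t)) * q p t.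
Proof.
move=> jp eta0 h_eta sep; apply: posterior_le => // v; rewrite !regionE => lv.
have [v' jv' le] := shift_mode_to_best (fun k => N_ge0 k t) mu_p eta0 h_eta sep jp lv.
by exists v' => //; rewrite (cost_changeE _ _ mu t v v') lerD2l.
Qed.

Let est_bounded : exists B : R, forall t k, `|est t k| <= B.
Proof.
suff H k : exists B : R, forall t, `|est t k| <= B.
  have /choice[B HB] := H; exists (\sum_k `|B k|) => t k.
  apply: le_trans (HB k t) _; rewrite (bigD1 k) //=.
  by apply: le_trans (ler_norm _) _; rewrite lerDl sumr_ge0.
have [B [B0 HB]] := fluctuates_below_bounded (pulls_ge0 x k) (@noise_small k).
(* After the first pull N >= 1, so (1 + N) / N <= 2; before it the estimate is [mu k]. *)
exists (`|mu k| + B * 2) => t; apply: le_trans (ler_normD _ _) _; rewrite lerD2l.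
have [N0|N0] := eqVneq (N k t) 0.
  by rewrite -/(N k t) N0 invr0 mulr0 normr0 mulr_ge0.
have N1 : 1 <= N k t.
  move: N0; rewrite /N /pulls -natr_sum pnatr_eq0 -lt0n => ?.
  by rewrite (ler_nat _ 1).
have Np : 0 < N k t by lra.
rewrite normrM normfV (gtr0_norm Np) ler_pdivrMr //.
apply: le_trans (HB t) _; rewrite -/(N k t); nra.
Qed.

(** The fluctuation bound gives N <= A + B (1 + A), so N is bounded wherever A is. *)
Let N_cvg_A j : N j @ \oo --> +oo -> A j @ \oo --> +oo.
Proof.
move=> /cvgryPge Noo.
have [B [B0 HB]] := fluctuates_below_bounded (A_ge0 j) (@pulls_near j).
apply/cvgryPge => L; near=> t.
have : (B + 1) * (L + 1) <= N j t by near: t; apply: Noo.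
have := HB t; rewrite ler_norml => /andP[_].
have := A_ge0 j t; have [//|] := leP L (A j t) => ? ? ? ?; nra.
Unshelve. all: by end_near. Qed.

Let some_N_cvg : exists l, N l @ \oo --> +oo.
Proof.
apply: contrapT => /forallNP H.
have {}H l : exists B, forall t, N l t <= B.
  by have [//|/H//] := nondecreasing_bounded_or_pinfty (@pulls_nd R _ x l).
have /choice[B HB] := H.
have [t] : exists t : nat, \sum_l B l < t%:R.
  by exists (Num.trunc (\sum_l B l)).+1; exact: truncnS_gt.
by rewrite ltNge -(sum_pulls x t) => /negP; apply; apply: ler_sum => l _; exact: HB.
Qed.

(** Some arm is pulled infinitely often because the pull counts add up to t; divergence then spreads
    from neighbour to neighbour. *)
Let A_cvg j : A j @ \oo --> +oo.
Proof.
have [l /N_cvg_A Al] := some_N_cvg.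
have [B HB] := est_bounded.
suff : `[< A j @ \oo --> +oo >] by move/asboolP.
apply: (@adjacent_connected c _ (fun j => `[< A j @ \oo --> +oo >]) l).
  exact/asboolP.
move=> i k /asboolP Ai ki; apply/asboolP.
(* With N k bounded, moving the mode from [i] to [k] costs a bounded amount, so the posterior of [k]
   is at least a constant times that of [i] and A k diverges with A i. *)
have [[n Hn]|/N_cvg_A //] := nondecreasing_bounded_or_pinfty (@pulls_nd R _ x k).
pose C := expR (n / 2 * (2 * B) ^+ 2).
have qC t : q i t <= C * q k t.
  have estB k' : est t k' <= B by apply: le_trans (ler_norm _) (HB t k').
  apply: le_trans (posterior_adjacent ki estB) _; apply: ler_wpM2r; first exact: ltW.
  rewrite ler_expR; have := Hn t; have := N_ge0 k t; rewrite -/(N k t) => ? ?.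
  have : (B - est t k) ^+ 2 <= (2 * B) ^+ 2.
    by have := HB t k; rewrite ler_norml => /andP[? ?]; nra.
  have := sqr_ge0 (B - est t k); nra.
have AC t : A i t <= C * A k t by rewrite /A mulr_sumr; apply: ler_sum.
have C0 : 0 < C by exact: expR_gt0.
move/cvgryPge: Ai => Ai; apply/cvgryPge => L; near=> t.
have : C * L <= A i t by near: t; apply: Ai.
by move=> /le_trans/(_ (AC t)); rewrite ler_pM2l.
Unshelve. all: by end_near. Qed.

Let N_close j (e : R) : 0 < e -> \forall t \near \oo, `|N j t - A j t| <= e * A j t.
Proof. by move=> e0; apply: fluctuates_below_small => //; exact: A_cvg. Qed.

Let N_cvg j : N j @ \oo --> +oo.
Proof.
have /cvgryPge Aj := @A_cvg j; apply/cvgryPge => L; near=> t.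
have h : `|N j t - A j t| <= 1 / 2 * A j t by near: t; apply: N_close; lra.
have : 2 * L <= A j t by near: t; apply: Aj.
by move: h; rewrite ler_norml => /andP[? ?] ?; lra.
Unshelve. all: by end_near. Qed.

Let est_close (e : R) : 0 < e -> \forall t \near \oo, forall k, `|est t k - mu k| <= e.
Proof.
move=> e0; apply: filter_forall => k; near=> t.
have N0 : 1 <= N k t by near: t; have /cvgryPge := @N_cvg k; apply.
have h : `|noise x phi mu k t| <= e * N k t.
  near: t; apply: fluctuates_below_small => //; exact: N_cvg.
move: h; rewrite noiseE -/(N k t) -/(est t k) normrM ger0_norm // mulrC ler_pM2r //; lra.
Unshelve. all: by end_near. Qed.

Let eta_exists (a : 'I_K -> R) :
  (forall i, i != p -> a i < (mu p - mu i) ^+ 2 / 2) ->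
  exists eta, [/\ 0 < eta, forall i, i != p -> mu i + 5 * eta <= mu p
    & forall i, i != p -> a i <= gain mu p eta i].
Proof.
move=> ha.
(* Expanded, [gain] is gap^2 / 2 - 3 gap eta + 5 eta^2 / 2, so a condition linear in eta
   suffices. *)
have H : \forall eta \near 0^'+, forall i, i != p ->
    5 * eta <= mu p - mu i /\ 3 * (mu p - mu i) * eta <= (mu p - mu i) ^+ 2 / 2 - a i.
  apply: filter_forall => i; have [_|ip] := eqVneq i p; first exact: nearW.
  have D0 : 0 < mu p - mu i by rewrite subr_gt0 p_best.
  have a0 : 0 < (mu p - mu i) ^+ 2 / 2 - a i by rewrite subr_gt0 ha.
  near=> eta => _; split.
    rewrite mulrC -ler_pdivlMr //; near: eta; apply: nbhs_right_le; exact: divr_gt0.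
  rewrite mulrC -ler_pdivlMr ?mulr_gt0 //; near: eta; apply: nbhs_right_le.
  by rewrite divr_gt0 ?mulr_gt0.
have [eta [eta0 Heta]] := filter_ex (filterI (nbhs_right_gt (0 : R)) H).
exists eta; split => // i ip; have [h1 h2] := Heta i ip; first by lra.
rewrite /gain; have := sqr_ge0 eta; nra.
Unshelve. all: by end_near. Qed.

(** Induction along the geodesic to [p]: once the arms strictly between are rare compared with [p],
    both arguments of the minimum in [posterior_best] diverge. The quarter in place of one half only
    serves to keep [gain] positive. *)
Let negligible_arm j : j != p ->
  (forall e, 0 < e -> \forall t \near \oo, q j t <= e * q p t) /\
  (forall e, 0 < e -> \forall t \near \oo, N j t <= e * N p t).
Proof.
have [eta [eta0 sep Hgain]] : exists eta, [/\ 0 < eta, forall i, i != p -> mu i + 5 * eta <= mu p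
    & forall i, i != p -> (mu p - mu i) ^+ 2 / 4 <= gain mu p eta i].
  by apply: eta_exists => i /p_best ?; nra.
have g0 i : i != p -> 0 < gain mu p eta i.
  move=> ip; apply: lt_le_trans (Hgain i ip); rewrite divr_gt0 ?exprn_gt0 //.
  by rewrite subr_gt0 p_best.
have K0 : 0 < K%:R :> R by rewrite ltr0n; exact: leq_ltn_trans (ltn_ord p).
move: j; apply: (@btw_ind c _ p) => j IH jp.
have Hq e : 0 < e -> \forall t \near \oo, q j t <= e * q p t.
  move=> e0.
  (* At most K arms at 1 / (8 K) each total N p / 8, which leaves [eta ^+ 2 / 4 * N p] in the second
     argument. *)
  have HN : \forall t \near \oo, forall i, btw c j i p -> i != j -> i != p ->
      N i t <= (8 * K%:R)^-1 * N p t.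
    apply: filter_forall => i; have [ji|_] := boolP (btw c j i p); last exact: nearW.
    have [_|ij] := eqVneq i j; first exact: nearW.
    have [_|ip] := eqVneq i p; first exact: nearW.
    have [_ /(_ (8 * K%:R)^-1) []] := IH i ji ij ip; first by rewrite invr_gt0 mulr_gt0.
    by move=> m _ Hm; exists m => // t mt _ _ _; exact: Hm.
  near=> t.
  have Nj : - ln e / gain mu p eta j <= N j t.
    by near: t; have /cvgryPge := @N_cvg j; apply.
  have Np : - ln e / (eta ^+ 2 / 4) <= N p t.
    by near: t; have /cvgryPge := @N_cvg p; apply.
  have close : forall k, `|est t k - mu k| <= eta by near: t; exact: est_close.
  have strict : forall i, btw c j i p -> i != j -> i != p -> N i t <= (8 * K%:R)^-1 * N p t.
    by near: t.
  apply: le_trans (posterior_best jp eta0 close sep) _.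
  apply: ler_wpM2r; first exact: ltW.
  rewrite -[leRHS]lnK ?posrE // ler_expR lerNl le_min; apply/andP; split.
    rewrite (bigD1 j) ?btw_start //=; apply: ler_wpDr.
      by apply: sumr_ge0 => i /andP[/andP[_ ip] _]; rewrite mulr_ge0 // ltW // g0.
    by rewrite -ler_pdivrMr // g0.
  have : \sum_(i | [&& btw c j i p, i != p & i != j]) N i t <= N p t / 8.
    apply: le_trans (_ : \sum_(i < K) (8 * K%:R)^-1 * N p t <= _).
      rewrite big_mkcond /=; apply: ler_sum => i _; case: ifP => [/and3P[? ? ?]|_].
        exact: strict.
      by rewrite mulr_ge0 // invr_ge0 mulr_ge0.
    rewrite sumr_const card_ord -[leLHS]mulr_natl.
    by have -> : K%:R * ((8 * K%:R)^-1 * N p t) = N p t / 8 by field; rewrite gt_eqF.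
  move: Np; rewrite ler_pdivrMr; last by rewrite divr_gt0 ?exprn_gt0.
  have := exprn_gt0 2 eta0; set S := \sum_(_ | _) _; set E := eta ^+ 2.
  by move=> ? ? ?; nra.
split=> // e e0.
(* Three factors 2 are lost: in summing, in N j <= 2 A j, and in A p <= 2 N p. *)
have e8 : 0 < e / 8 by lra.
have HA := sum_near_le (fun t => ltW (q_gt0 p t)) e8 (@A_cvg p) (Hq _ e8).
near=> t.
have h1 : A j t <= 2 * (e / 8) * A p t by near: t.
have h2 : `|N j t - A j t| <= 1 * A j t by near: t; apply: N_close.
have h3 : `|N p t - A p t| <= 1 / 2 * A p t by near: t; apply: N_close; lra.
move: h2 h3; rewrite !ler_norml => /andP[_ h2] /andP[h3 _].
have := A_ge0 p t; nra.
Unshelve. all: by end_near. Qed.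

Let q_best_ge : \forall t \near \oo, 1 / 2 <= q p t.
Proof.
have K0 : 0 < K%:R :> R by rewrite ltr0n; exact: leq_ltn_trans (ltn_ord p).
have H : \forall t \near \oo, forall j, j != p -> q j t <= (2 * K%:R)^-1 * q p t.
  apply: filter_forall => j; have [_|jp] := eqVneq j p; first exact: nearW.
  have [/(_ (2 * K%:R)^-1) H _] := negligible_arm jp.
  have [|m _ Hm] := H; first by rewrite invr_gt0 mulr_gt0.
  by exists m => // t mt _; exact: Hm.
near=> t.
have Ht : forall j, j != p -> q j t <= (2 * K%:R)^-1 * q p t by near: t.
have S : \sum_(k < K) q k t = 1 by exact: sum_posterior.
have : \sum_(k < K | k != p) q k t <= 1 / 2.
  apply: le_trans (_ : \sum_(k < K) (2 * K%:R)^-1 <= _).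
    rewrite big_mkcond /=; apply: ler_sum => i _; case: ifP => [/Ht h|_].
      by apply: le_trans h _; rewrite ler_piMr // invr_ge0 mulr_ge0.
    by rewrite invr_ge0 mulr_ge0.
  rewrite sumr_const card_ord -[leLHS]mulr_natl.
  by have -> : K%:R * (2 * K%:R)^-1 = 1 / 2 :> R by field; rewrite gt_eqF.
by move: S; rewrite (bigD1 p) //= => ? ?; lra.
Unshelve. all: by end_near. Qed.

(** The whole geodesic sum is kept, with a free rate for each arm: a neighbour of [p] uses its own
    term, any other arm also that of the neighbour lying on its geodesic. *)
Let q_upper j (a : 'I_K -> R) : j != p ->
  (forall i, i != p -> 0 < a i < (mu p - mu i) ^+ 2 / 2) ->
  \forall t \near \oo, q j t <= expR (- \sum_(i | btw c j i p && (i != p)) a i * A i t).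
Proof.
move=> jp ha.
(* The midpoint splits the slack: the upper half lets [gain] reach [b] with eta > 0, the lower half
   pays for replacing N by A. *)
pose b i := (a i + (mu p - mu i) ^+ 2 / 2) / 2.
have hb i : i != p -> a i < b i < (mu p - mu i) ^+ 2 / 2.
  by move=> /ha /andP[? ?]; rewrite /b; apply/andP; split; lra.
have [eta [eta0 sep Hgain]] : exists eta, [/\ 0 < eta, forall i, i != p -> mu i + 5 * eta <= mu p
    & forall i, i != p -> b i <= gain mu p eta i].
  by apply: eta_exists => i /hb /andP[].
(* With every N i at most [e * N p], the total [G * e] is at most [eta ^+ 2 / 2], so misfitting [p]
   is never the cheaper option. *)
pose G := \sum_(i | i != p) (gain mu p eta i + 2 * eta ^+ 2).
have g0 i : i != p -> 0 <= gain mu p eta i.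
  move=> ip; have := Hgain i ip; have /andP[? ?] := hb i ip; have /andP[? ?] := ha i ip; lra.
have G0 : 0 <= G.
  by apply: sumr_ge0 => i ip; rewrite addr_ge0 ?g0 // mulr_ge0 ?sqr_ge0.
pose e := eta ^+ 2 / 2 / (G + 1).
have e2 := exprn_gt0 2 eta0.
have e0 : 0 < e by rewrite !divr_gt0 //; lra.
have HN : \forall t \near \oo, forall i, i != p -> N i t <= e * N p t /\ a i * A i t <= b i * N i t.
  apply: filter_forall => i; have [_|ip] := eqVneq i p; first exact: nearW.
  have [_ /(_ e e0) H] := negligible_arm ip.
  have /andP[a0 _] := ha i ip; have /andP[ab _] := hb i ip.
  have ba : 0 < (b i - a i) / b i by rewrite divr_gt0 ?subr_gt0 // (lt_trans a0).
  near=> t => _; split; first by near: t.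
  have : `|N i t - A i t| <= (b i - a i) / b i * A i t by near: t; exact: N_close.
  rewrite ler_norml => /andP[+ _].
  move=> h; have b0 : 0 < b i by exact: lt_trans ab.
  have -> : a i * A i t = b i * (A i t - (b i - a i) / b i * A i t) by field; rewrite gt_eqF.
  by rewrite ler_pM2l //; lra.
near=> t.
have close : forall k, `|est t k - mu k| <= eta by near: t; exact: est_close.
have Ht : forall i, i != p -> N i t <= e * N p t /\ a i * A i t <= b i * N i t by near: t.
apply: le_trans (posterior_best jp eta0 close sep) _.
rewrite -[leRHS]mulr1; apply: ler_pM; rewrite ?expR_ge0 ?q_le1 ?(ltW (q_gt0 _ _)) //.
rewrite ler_expR lerN2 le_min.
have -> : \sum_(i | btw c j i p && (i != p)) a i * A i t <=
    \sum_(i | btw c j i p && (i != p)) N i t * gain mu p eta i.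
  apply: ler_sum => i /andP[_ ip]; have [_ h] := Ht i ip; apply: le_trans h _.
  by rewrite mulrC ler_wpM2l // Hgain.
rewrite lerBrDr.
apply: le_trans (_ : \sum_(i | i != p) (gain mu p eta i + 2 * eta ^+ 2) * N i t <= _).
  rewrite mulr_sumr.
  have -> : \sum_(i | i != p) (gain mu p eta i + 2 * eta ^+ 2) * N i t =
      \sum_(i | i != p) gain mu p eta i * N i t + \sum_(i | i != p) 2 * eta ^+ 2 * N i t.
    by rewrite -big_split /=; apply: eq_bigr => i _; rewrite mulrDl.
  apply: lerD.
    rewrite [leLHS]big_mkcond [leRHS]big_mkcond /=; apply: ler_sum => i _.
    have [ip|//] := boolP (i != p); last by rewrite andbF.
    rewrite andbT; case: ifP => _; last by rewrite mulr_ge0 ?g0.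
    have [_ h] := Ht i ip; apply: le_trans h _.
    by rewrite ler_wpM2r // Hgain.
  rewrite [leLHS]big_mkcond [leRHS]big_mkcond /=; apply: ler_sum => i _.
  have [ip|//] := boolP (i != p); last by rewrite andbF.
  by case: ifP => _; rewrite // mulr_ge0 // mulr_ge0 ?sqr_ge0.
apply: le_trans (_ : G * (e * N p t) <= _).
  rewrite mulr_suml; apply: ler_sum => i ip; apply: ler_wpM2l.
    by rewrite addr_ge0 ?g0 // mulr_ge0 ?sqr_ge0.
  by have [] := Ht i ip.
rewrite mulrA; apply: ler_wpM2r => //.
rewrite /e mulrCA ler_piMr ?divr_ge0 ?sqr_ge0 // ler_pdivrMr; lra.
Unshelve. all: by end_near. Qed.

(** Adjacency enters here: a single move takes the mode from [p] to [j], at a cost in N j alone, and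
    the posterior of [p] is eventually at least 1 / 2. *)
Let q_lower j (b : R) : j != p -> adjacent c j p -> (mu p - mu j) ^+ 2 / 2 < b ->
  \forall t \near \oo, expR (- (b * A j t)) <= q j t.
Proof.
move=> jp adj hb.
set D := mu p - mu j in hb *.
have D0 : 0 < D by rewrite subr_gt0 p_best.
pose g := (b - D ^+ 2 / 2) / 2.
have gg0 : 0 < g by rewrite /g; lra.
have D2 : 0 < D ^+ 2 by rewrite exprn_gt0.
have [eta [eta0 etaD etag]] : exists eta, [/\ 0 < eta, eta <= D & 4 * D * eta <= g].
  have H : \forall eta \near 0^'+, eta <= D /\ 4 * D * eta <= g.
    near=> eta; split; first by near: eta; apply: nbhs_right_le.
    rewrite mulrC -ler_pdivlMr ?mulr_gt0 //; near: eta; apply: nbhs_right_le.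
    by apply: divr_gt0 => //; rewrite mulr_gt0.
  by have [eta [? []]] := filter_ex (filterI (nbhs_right_gt (0 : R)) H); exists eta.
pose b' := (D + 2 * eta) ^+ 2 / 2.
have b'0 : 0 <= b' by rewrite divr_ge0 ?sqr_ge0.
have b'b : b' < b by rewrite /b'; rewrite /g in etag; nra.
(* Chosen so that N <= (1 + e) A gives b A - b' N >= e A, which is eventually at least 1; exp (- 1)
   <= 1 / 2 then absorbs the bound on [q p]. *)
pose e := (b - b') / (b' + 1).
have b1 : 0 < b' + 1 by rewrite ltr_wpDl.
have e0 : 0 < e by rewrite divr_gt0 // subr_gt0.
near=> t.
have close : forall k, `|est t k - mu k| <= eta by near: t; exact: est_close.
have qp : 1 / 2 <= q p t by near: t.
have At : 1 / e <= A j t by near: t; have /cvgryPge := @A_cvg j; apply.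
have : `|N j t - A j t| <= e * A j t by near: t; exact: N_close.
rewrite ler_norml => /andP[_ NA].
have hM k : est t k <= mu p + eta.
  have := close k; rewrite ler_norml => /andP[_ ?].
  have : mu k <= mu p by have [->|/p_best/ltW] := eqVneq k p.
  lra.
have Q := posterior_adjacent adj hM.
have : q p t <= expR (N j t * b') * q j t.
  apply: le_trans Q _; apply: ler_wpM2r; first exact: ltW.
  rewrite ler_expR mulrAC -mulrA; apply: ler_wpM2l => //; rewrite /b' ler_pM2r //.
  have := close j; rewrite ler_norml => /andP[? ?].
  by have := hM j; rewrite /D in D0 *; nra.
have half : expR (- 1) <= 1 / 2 :> R.
  rewrite expRN mul1r lef_pV2 ?posrE ?expR_gt0 //.
  by have := expR_ge1Dx (1 : R); lra.
move=> H; have : expR (- 1) <= expR (N j t * b') * q j t.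
  by apply: le_trans half (le_trans qp H).
rewrite -ler_pdivrMl ?expR_gt0 // -expRN -expRD; apply: le_trans.
rewrite ler_expR -opprD lerN2.
have e1 : 1 <= e * A j t by rewrite -ler_pdivrMl // mulrC.
have eb : e * (b' + 1) = b - b' by rewrite /e divfK // gt_eqF.
have := A_ge0 j t; nra.
Unshelve. all: by end_near. Qed.

Let cA j := (mu p - mu j) ^+ 2 / 2.

Let cA_gt0 j : j != p -> 0 < cA j.
Proof. by move=> /p_best h; rewrite divr_gt0 // exprn_gt0 // subr_gt0. Qed.

Let A_adjacent j : j != p -> adjacent c j p ->
  (fun T => A j T / ln T%:R) @ \oo --> (cA j)^-1.
Proof.
move=> jp adj; have c0 := cA_gt0 jp; apply: cvg_div_ln => // [a /andP[a0 ac]|b cb].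
  have H : \forall t \near \oo, q j t * expR (a * A j t) <= 1.
    (* The other rates are arbitrary admissible ones: their terms are nonnegative and get
       dropped. *)
    pose f i := if i == j then a else cA i / 2.
    have hf i : i != p -> 0 < f i < (mu p - mu i) ^+ 2 / 2.
      move=> /cA_gt0 ci; rewrite /f; case: eqVneq => [->|_]; first by rewrite a0.
      by rewrite -/(cA i); apply/andP; split; lra.
    have [m _ Hm] := q_upper jp hf; exists m => // t mt /=.
    rewrite -[leRHS](expR0 R) -(addNr (a * A j t)) expRD ler_pM2r ?expR_gt0 //.
    apply: le_trans (Hm t mt) _; rewrite ler_expR lerN2 (bigD1 j) ?btw_start //=.
    rewrite {1}/f eqxx lerDl; apply: sumr_ge0 => i /andP[/andP[_ ip] _].
    by rewrite mulr_ge0 // ltW //; case/andP: (hf i ip).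
  have [C HC] := growth_upper (q01 j) (fun=> ler01) a0 H.
  pose B := `|C| + a * expR a + 1.
  have ae : 0 <= a * expR a by rewrite mulr_ge0 ?expR_ge0 // ltW.
  have B0 : 0 < B by rewrite ltr_wpDl // addr_ge0.
  exists (ln B); near=> T.
  have T1 : (1 : R) <= T%:R by near: T; exact: nbhs_infty_ger.
  rewrite -lnM ?posrE //; last by lra.
  rewrite -[leLHS]expRK ler_ln ?posrE ?expR_gt0 ?mulr_gt0 //; last by lra.
  apply: le_trans (HC T) _; rewrite sumr_const card_ord /B.
  have := ler_norm C; have := normr_ge0 C; nra.
have b0 : 0 < b by lra.
have H : \forall t \near \oo, 1 <= q j t * expR (b * A j t).
  have [m _ Hm] := q_lower jp adj cb; exists m => // t mt /=.
  rewrite -[leLHS](expR0 R) -(addNr (b * A j t)) expRD ler_pM2r ?expR_gt0 //.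
  exact: Hm.
have [C HC] := growth_lower (fun=> ler01) b0 H.
exists (- ln (b / 2)); near=> T.
have T1 : (1 : R) <= T%:R by near: T; exact: nbhs_infty_ger.
have T2 : 2 * C / b <= T%:R by near: T; exact: nbhs_infty_ger.
have bT : 0 < b / 2 * T%:R by rewrite mulr_gt0 //; lra.
rewrite opprK addrC -lnM ?posrE; try lra.
rewrite -[leRHS]expRK ler_ln ?posrE ?expR_gt0 //.
apply: le_trans (HC T); rewrite sumr_const card_ord.
by move: T2; rewrite ler_pdivrMr // => ?; lra.
Unshelve. all: by end_near. Qed.

(** The sequence [r] mediates: it dominates [q j * expR (a * A j)] because [n] is on the geodesic of
    [j], and is dominated by [q n * expR (2 * w * A n)] because [n] is adjacent to [p]. Summing both
    gives a A j <= 2 w A n + const with [w] as small as desired. *)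
Let A_nonadjacent j : j != p -> ~~ adjacent c j p ->
  (fun T => A j T / ln T%:R) @ \oo --> (0 : R).
Proof.
move=> jp nadj; have [n [np nj jnp adj]] := btw_nonadjacent jp nadj.
have cj := cA_gt0 jp; have cn := cA_gt0 np.
have An := A_adjacent np adj.
apply/cvgrPdist_le => e e0.
pose a := cA j / 2; have a0 : 0 < a by rewrite /a; lra.
pose L := (cA n)^-1 + 1; have L0 : 0 < L by rewrite /L ltr_wpDl // invr_ge0 ltW.
(* [L] eventually bounds A n / ln T, so 2 w A n uses half of a e ln T; the constant [ln B] gets the
   other half. *)
have [w [w0 wc wL]] : exists w, [/\ 0 < w, w < cA n & 2 * w * L <= a * e / 2].
  have H : \forall w \near 0^'+, w < cA n /\ 2 * w * L <= a * e / 2.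
    near=> w; split; first by near: w; apply: nbhs_right_lt.
    rewrite mulrAC mulrC -ler_pdivlMr ?mulr_gt0 //; near: w; apply: nbhs_right_le.
    by apply: divr_gt0; [apply: divr_gt0 => //; exact: mulr_gt0|exact: mulr_gt0].
  by have [w [? []]] := filter_ex (filterI (nbhs_right_gt (0 : R)) H); exists w.
pose r t := expR (- ((cA n - w) * A n t)).
have r0 t : 0 <= r t by exact: expR_ge0.
have Hj : \forall t \near \oo, q j t * expR (a * A j t) <= r t.
  pose f i := if i == n then cA n - w else cA i / 2.
  have hf i : i != p -> 0 < f i < (mu p - mu i) ^+ 2 / 2.
    move=> /cA_gt0 ci; rewrite /f; case: eqVneq => [->|_]; rewrite -/(cA _); apply/andP; split; lra.
  have [m _ Hm] := q_upper jp hf; exists m => // t mt /=.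
  have -> : r t = expR (- (a * A j t) - (cA n - w) * A n t) * expR (a * A j t).
    by rewrite -expRD /r; congr expR; lra.
  rewrite ler_pM2r ?expR_gt0 //.
  apply: le_trans (Hm t mt) _; rewrite ler_expR -opprD lerN2 (bigD1 j) ?btw_start //=.
  rewrite (bigD1 n) /=; last by rewrite jnp np nj.
  have -> : f j = a by rewrite /f eq_sym (negbTE nj).
  have -> : f n = cA n - w by rewrite /f eqxx.
  rewrite addrA lerDl; apply: sumr_ge0 => i /andP[/andP[/andP[_ ip] _] _].
  by rewrite mulr_ge0 // ltW //; case/andP: (hf i ip).
have Hn : \forall t \near \oo, r t <= q n t * expR (2 * w * A n t).
  have cnw : (mu p - mu n) ^+ 2 / 2 < cA n + w by rewrite -/(cA n); lra.
  have [m _ Hm] := q_lower np adj cnw; exists m => // t mt /=.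
  have -> : r t = expR (- ((cA n + w) * A n t)) * expR (2 * w * A n t).
    by rewrite -expRD /r; congr expR; ring.
  by rewrite ler_pM2r ?expR_gt0 //; exact: Hm.
have [C1 HC1] := growth_upper (q01 j) r0 a0 Hj.
have w2 : 0 < 2 * w by lra.
have [C2 HC2] := growth_lower r0 w2 Hn.
pose D := a * expR a / (2 * w).
have D0 : 0 <= D.
  by apply: divr_ge0; [apply: mulr_ge0; [exact: ltW|exact: expR_ge0]|exact: ltW].
pose B := `|C1| + D * (`|C2| + 1) + 1.
have B1 : 1 <= B by rewrite /B lerDr; apply: addr_ge0 => //; apply: mulr_ge0 => //; exact: addr_ge0.
have key T : a * A j T <= 2 * w * A n T + ln B.
  set E := expR (2 * w * A n T).
  have E1 : 1 <= E by rewrite -(expR0 R) ler_expR mulr_ge0 // ltW.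
  have : expR (a * A j T) <= B * E.
    apply: le_trans (HC1 T) _; have h := HC2 T; rewrite -/E in h.
    set S := \sum_(t < T) r t in h *.
    have -> : a * expR a * S = D * (2 * w * S) by rewrite /D; field; rewrite gt_eqF.
    have h' : 2 * w * S <= (`|C2| + 1) * E.
      by have := ler_norm C2; have := normr_ge0 C2; nra.
    have h2 : D * (2 * w * S) <= D * ((`|C2| + 1) * E) by rewrite ler_wpM2l.
    have h3 : C1 <= `|C1| * E by have := ler_norm C1; have := normr_ge0 C1; nra.
    by rewrite /B; nra.
  move=> h; rewrite -(expRK (a * A j T)) -(expRK (2 * w * A n T)) -/E addrC -lnM ?posrE //; try lra.
  by rewrite ler_ln ?posrE ?expR_gt0 // mulr_gt0; lra.
near=> T.
have L1 : 1 <= ln (T%:R : R).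
  by near: T; have /cvgryPge := @cvg_ln_nat_pinfty R; apply.
have L2 : ln B / (a * e / 2) <= ln (T%:R : R).
  by near: T; have /cvgryPge := @cvg_ln_nat_pinfty R; apply.
have : `|(cA n)^-1 - A n T / ln T%:R| <= 1.
  near: T; move/cvgrPdist_le: An; apply; exact: ltr01.
rewrite ler_norml => /andP[h _].
have {}h : A n T <= L * ln T%:R by rewrite -ler_pdivrMr /L; lra.
have l0 : 0 < ln T%:R :> R by lra.
rewrite sub0r normrN ger0_norm; last by rewrite divr_ge0 // ltW.
rewrite ler_pdivrMr // -(ler_pM2l a0).
move: L2; rewrite ler_pdivrMr; last by apply: divr_gt0 => //; exact: mulr_gt0.
move=> L2; apply: le_trans (key T) _.
have : 2 * w * A n T <= a * e / 2 * ln T%:R.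
  apply: le_trans (_ : 2 * w * (L * ln T%:R) <= _); first by rewrite ler_wpM2l // ltW.
  by rewrite mulrA ler_wpM2r // ltW.
lra.
Unshelve. all: by end_near. Qed.

Lemma pulls_asymptotics j : j != p ->
  (fun T => N j T / ln T%:R) @ \oo -->
    (if adjacent c j p then 2 / (mu p - mu j) ^+ 2 else 0).
Proof.
move=> jp.
have NA : (fun T => N j T / A j T) @ \oo --> (1 : R).
  apply/cvgrPdist_le => e e0; near=> T.
  have A1 : 1 <= A j T by near: T; have /cvgryPge := @A_cvg j; apply.
  have A0 : 0 < A j T by lra.
  have : `|N j T - A j T| <= e * A j T by near: T; exact: N_close.
  have -> : 1 - N j T / A j T = (A j T - N j T) / A j T by field; rewrite gt_eqF.
  by rewrite normrM normfV (gtr0_norm A0) ler_pdivrMr // distrC.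
have AL : (fun T => A j T / ln T%:R) @ \oo -->
    (if adjacent c j p then 2 / (mu p - mu j) ^+ 2 else 0).
  case: ifP => adj; last by apply: A_nonadjacent => //; rewrite adj.
  by rewrite -invf_div; exact: A_adjacent.
rewrite -[X in _ --> X]mul1r.
apply: cvg_trans (cvgM NA AL); apply: near_eq_cvg; near=> T.
have A1 : 1 <= A j T by near: T; have /cvgryPge := @A_cvg j; apply.
rewrite /= mulrA divfK // gt_eqF //; lra.
Unshelve. all: by end_near. Qed.

End asymptotics.

(** * Measurability of the posterior *)

Section profile_countable.
Context {R : realType} {K : nat}.
Variables (Theta : set ('I_K -> R)) (c : bool) (j : 'I_K).
Hypothesis regionE : argmax_region Theta j = mode_region c j.

Let round (m : nat) (v : 'I_K -> R) (k : 'I_K) : rat :=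
  (Num.floor (m.+1%:R * v k))%:~R / m.+1%:R.

Let ratr_round m v k :
  ratr (round m v k) = (Num.floor (m.+1%:R * v k))%:~R / m.+1%:R :> R.
Proof. by rewrite fmorph_div /= ratr_int ratr_nat. Qed.

Let round_cvg v k : (fun m => ratr (round m v k)) @ \oo --> v k.
Proof.
apply/cvgrPdist_le => e e0; near=> m.
have m0 : 0 < m.+1%:R :> R by [].
have hm : m.+1%:R^-1 <= e.
  near: m; have [m0 m0e] : exists m : nat, m.+1%:R^-1 < e.
    by exists (Num.trunc e^-1); rewrite invf_plt ?posrE // truncnS_gt.
  exists m0 => // m /= m0m; apply: le_trans (ltW m0e).
  by rewrite lef_pV2 ?posrE // ler_nat.
apply: le_trans hm; rewrite ratr_round.
have -> : v k - (Num.floor (m.+1%:R * v k))%:~R / m.+1%:R =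
    (m.+1%:R * v k - (Num.floor (m.+1%:R * v k))%:~R) / m.+1%:R :> R.
  by field; rewrite gt_eqF.
have /andP[h1 h2] := floor_itv (m.+1%:R * v k : R).
rewrite ger0_norm; last by rewrite divr_ge0 // subr_ge0.
by rewrite ler_pdivrMr // mulVf ?gt_eqF // lerBlDl -intrD1 ltW.
Unshelve. all: by end_near. Qed.

Let round_region m v : mode_region c j v -> mode_region c j (fun k => ratr (round m v k) : R).
Proof.
move=> jv k i /jv kv; rewrite !ratr_round ler_pM2r ?invr_gt0 // ler_int.
by apply: le_floor; rewrite ler_pM2l.
Qed.

(* Rounding down to multiples of 1/(m+1) is monotone, so it preserves the order constraints
   and rational profiles suffice; this is what makes the posterior measurable in the data. *)
Lemma profile_likelihood_countable : exists u : nat -> 'I_K -> R,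
  (forall n, argmax_region Theta j (u n)) /\
  forall D, profile_likelihood 1 Theta j D = sups (fun n => likelihood 1 (u n) D) 0.
Proof.
(* Codes of no admissible profile fall back on the constant profile 0, which belongs to every mode
   region. *)
pose u n : 'I_K -> R := if unpickle n is Some f then
    (if `[< mode_region c j (fun k => ratr ((f : {ffun 'I_K -> rat}) k) : R) >]
     then (fun k => ratr (f k)) else (fun=> 0))
  else (fun=> 0).
have uj n : argmax_region Theta j (u n).
  rewrite regionE /u; case: unpickle => [f|]; last by move=> ? ?.
  by case: asboolP => // _ ? ?.
exists u; split => // D.
have ub : has_ubound [set likelihood 1 v D | v in argmax_region Theta j].
  by exists (likelihood_max ^+ size D) => _ [v _ <-]; exact: likelihood_le.
have sE : sdrop (fun n => likelihood 1 (u n) D) 0 = range (fun n => likelihood 1 (u n) D).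
  by apply/seteqP; split => [_ [n _ <-]|_ [n _ <-]]; exists n.
rewrite /sups /= sE; apply/eqP; rewrite eq_le; apply/andP; split; last first.
  apply: ge_sup; first by exists (likelihood 1 (u 0%N) D); exists 0%N.
  by move=> _ [n _ <-]; apply: ub_le_sup => //; exists (u n).
apply: ge_sup; first by exists (likelihood 1 (u 0%N) D); exists (u 0%N).
move=> _ [v + <-]; rewrite regionE => jv.
pose f m k : R := ratr (round m v k).
have cv : (fun m => likelihood 1 (f m) D) @ \oo --> likelihood 1 v D.
  under eq_fun do rewrite likelihoodE.
  rewrite likelihoodE; apply: cvgMl_tmp; apply: continuous_cvg; first exact: continuous_expR.
  apply: cvgN; elim: (D) => [|o D' IH].
    by rewrite /cost big_nil; under eq_fun do rewrite big_nil; exact: cvg_cst.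
  rewrite /cost big_cons; under eq_fun do rewrite big_cons.
  apply: cvgD => //; apply: cvgMr_tmp.
  rewrite expr2; under eq_fun do rewrite expr2.
  by apply: cvgM; apply: cvgB; [exact: round_cvg|exact: cvg_cst|exact: round_cvg|exact: cvg_cst].
rewrite -(cvg_lim _ cv) //; apply: limr_le; first by apply/cvg_ex; eexists; exact: cv.
apply: nearW => m; apply: ub_le_sup.
  by exists (likelihood_max ^+ size D) => _ [n _ <-]; exact: likelihood_le.
exists (pickle [ffun k => round m v k]) => //; congr likelihood.
rewrite /u pickleK; have E : (fun k => ratr ([ffun k => round m v k] k)) = f m.
  by apply/funext => k; rewrite ffunE.
by case: asboolP => [_|]; rewrite E //; case; exact: round_region.
Qed.

End profile_countable.

Section posterior_measurable.
Context {R : realType} {K : nat} {d : measure_display} {T : measurableType d}.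
Variables (Theta : set ('I_K -> R)) (c : bool).
Hypothesis regionE : forall j, argmax_region Theta j = mode_region c j.
Variables (x : nat -> T -> 'I_K) (phi : nat -> T -> R) (t : nat).
Hypothesis mx : forall i j, (i < t)%N -> measurable_fun setT (fun w => (x i w == j)%:R : R).
Hypothesis mphi : forall i, (i < t)%N -> measurable_fun setT (phi i).

Let D w := observations (x^~ w) (phi^~ w) t.

Lemma measurable_likelihood v : measurable_fun setT (fun w => likelihood 1 v (D w)).
Proof.
have -> : (fun w => likelihood 1 v (D w)) = fun w =>
    likelihood_max ^+ t * expR (- \sum_(i < t) (\sum_j v j * (x i w == j)%:R - phi i w) ^+ 2 / 2).
  apply/funext => w; rewrite likelihoodE /D size_map size_iota cost_observationsE.
  congr (_ * expR (- _)); apply: eq_bigr => i _; congr ((_ - _) ^+ 2 / 2).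
  rewrite (bigD1 (x i w)) //= eqxx mulr1 big1 ?addr0 // => k.
  by rewrite eq_sym => /negbTE ->; rewrite mulr0.
apply: measurable_funM => //; apply: measurableT_comp => //; apply: measurable_funN.
apply: measurable_sum => i; apply: measurable_funM => //.
apply: measurable_funX; apply: measurable_funB; last exact: mphi.
by apply: measurable_sum => j; apply: measurable_funM => //; exact: mx.
Qed.

Lemma measurable_posterior j :
  measurable_fun setT (fun w => posterior 1 Theta uniform_prior (D w) j).
Proof.
have mp k : measurable_fun setT (fun w => profile_likelihood 1 Theta k (D w)).
  have [u [uk uE]] := profile_likelihood_countable (@regionE k).
  under eq_fun do rewrite uE.
  apply: measurable_fun_sups; last by move=> n; exact: measurable_likelihood.
  by move=> w _; exists (likelihood_max ^+ size (D w)) => _ [n _ <-]; exact: likelihood_le.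
have T0 k : argmax_region Theta k !=set0 by rewrite regionE; exists (fun=> 0) => ? ?.
have -> : (fun w => posterior 1 Theta uniform_prior (D w) j) = fun w =>
    profile_likelihood 1 Theta j (D w) * K%:R^-1 *
    expR (- ln (\sum_(k < K) profile_likelihood 1 Theta k (D w) * K%:R^-1)).
  apply/funext => w; rewrite expRN lnK //.
  by rewrite posrE; exact: (sum_profile_likelihood_gt0 T0 j).
apply: measurable_funM; first exact: measurable_funM.
apply: measurableT_comp => //; apply: measurable_funN; apply: measurableT_comp => //.
by apply: measurable_sum => k; exact: measurable_funM.
Qed.

End posterior_measurable.

(** * Almost sure properties of a run *)

Section feedback_integral.
Context {R : realType} {d : measure_display} {Omega : measurableType d}.
Variables (P : probability Omega R) (F : set Omega) (Y : Omega -> R).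
Variable nu : probability (measurableTypeR R) R.
Hypothesis mF : measurable F.
Hypothesis mY : measurable_fun setT Y.
Hypothesis law : forall B : set (measurableTypeR R), measurable B ->
  P (F `&` Y @^-1` B) = (P F * nu B)%E.

(** [P] restricted to [F] and pushed forward by [Y] is [nu] scaled by [P F]. It is applied with [F]
    an event of the past on which arm j is chosen. *)
Lemma ge0_integral_law (g : R -> R) : measurable_fun setT g -> (forall y, 0 <= g y) ->
  (\int[P]_(w in F) (g (Y w))%:E = P F * \int[nu]_y (g y)%:E)%E.
Proof.
move=> mg g0.
pose m := mrestr P mF.
have mgY : measurable_fun setT (fun w => (g (Y w))%:E).
  by apply/measurable_EFinP; apply: measurableT_comp.
have mgE : measurable_fun [set: measurableTypeR R] (fun y => (g y)%:E).
  by apply/measurable_EFinP.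
have -> : (\int[P]_(w in F) (g (Y w))%:E = \int[m]_(w in F) (g (Y w))%:E)%E.
  by apply: eq_measure_integral => A mA AF; rewrite /m /= /mrestr setIidl.
have -> : (\int[m]_(w in F) (g (Y w))%:E = \int[m]_w (g (Y w))%:E)%E.
  have mFc := measurableC mF.
  have dF : [disjoint F & ~` F] by apply/disj_setPCl.
  have mU : measurable_fun (F `|` ~` F) (fun w => (g (Y w))%:E) by rewrite setUv.
  have U0 w : (F `|` ~` F) w -> (0 <= (g (Y w))%:E)%E by rewrite lee_fin.
  rewrite -[in RHS](setUv F) ge0_integral_setU //.
  have -> : (\int[m]_(w in ~` F) (g (Y w))%:E = \int[mzero]_(w in ~` F) (g (Y w))%:E)%E.
    apply: eq_measure_integral => A mA AF; rewrite /m /= /mrestr /mzero.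
    by rewrite (_ : A `&` F = set0) ?measure0 // disjoints_subset.
  by rewrite integral_measure_zero adde0.
have PF0 : 0 <= fine (P F) by apply: fine_ge0.
have := @ge0_integral_pushforward _ _ Omega (measurableTypeR R) R Y mY m setT
  (fun y => (g y)%:E) measurableT mgE (fun y _ => g0 y).
rewrite preimage_setT => <-.
transitivity (\int[mscale (NngNum PF0) nu]_y (g y)%:E)%E.
  apply: eq_measure_integral => B mB _.
  transitivity (P F * nu B)%E; first by rewrite -law // setIC.
  by rewrite /= /mscale /= fineK // fin_num_measure.
rewrite ge0_integral_mscale //; last by move=> y _; rewrite lee_fin.
by rewrite /= fineK // fin_num_measure.
Qed.

Lemma integral_law (g : R -> R) :
  nu.-integrable setT (fun y : measurableTypeR R => (g y)%:E) ->
  (\int[nu]_y (g y)%:E = 0)%E -> (\int[P]_(w in F) (g (Y w))%:E = 0)%E.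
Proof.
move=> gi; have mg : measurable_fun setT g.
  by apply/measurable_EFinP; exact: measurable_int gi.
rewrite [in LHS]integralE => g0; rewrite integralE.
have -> : (\int[P]_(w in F) ((fun w => (g (Y w))%:E)^\+)%E w =
    P F * \int[nu]_y ((fun y => (g y)%:E)^\+)%E y)%E.
  under eq_integral => w _ do rewrite -[(fun _ => _)]/(EFin \o (g \o Y)) funerpos.
  under [in RHS]eq_integral => y _ do rewrite -[(fun _ => _)]/(EFin \o g) funerpos.
  by apply: (ge0_integral_law (g := g^\+%R)) => //; exact: measurable_funrpos.
have -> : (\int[P]_(w in F) ((fun w => (g (Y w))%:E)^\-)%E w =
    P F * \int[nu]_y ((fun y => (g y)%:E)^\-)%E y)%E.
  under eq_integral => w _ do rewrite -[(fun _ => _)]/(EFin \o (g \o Y)) funerneg.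
  under [in RHS]eq_integral => y _ do rewrite -[(fun _ => _)]/(EFin \o g) funerneg.
  by apply: (ge0_integral_law (g := g^\-%R)) => //; exact: measurable_funrneg.
rewrite -muleBr ?g0 ?mule0 //; first exact: fin_num_measure.
exact: integrable_add_def gi.
Qed.

End feedback_integral.

(** * The two martingales of a run: reward noise and arm sampling *)

Section bandit.
Context {R : realType} {K : nat} {d : measure_display} {Omega : measurableType d}.
Variables (nu : 'I_K -> probability (measurableTypeR R) R) (mu : 'I_K -> R).
Variables (P : probability Omega R) (x : nat -> Omega -> 'I_K).
Variable phi : nat -> {RV P >-> R}.
Hypothesis environment : bandit_environment x phi nu.

(** The martingale section is stated for generating families; [past] and [past_and_arm] unfold to
    the sigma-algebras that these two families generate. *)
Definition past_generators t : set (set Omega) :=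
  \bigcup_(i in [set i | (i < t)%N]) (sigma_gen_arm x i `|` sigma_gen_feedback phi i).

Definition past_and_arm_generators t : set (set Omega) :=
  past x phi t `|` sigma_gen_arm x t.

Lemma measurable_sigma_gen_arm t : sigma_gen_arm x t `<=` measurable.
Proof.
move=> _ [B _ <-]; rewrite setTI.
have -> : x t @^-1` B = \bigcup_(j in B) x t @^-1` [set j].
  by apply/seteqP; split => [w Bw|w [j Bj xj]]; [exists (x t w)|rewrite /preimage /= xj].
apply: fin_bigcup_measurable; first exact: finite_finset.
by move=> j _; exact: (arm_measurable environment).
Qed.

Lemma measurable_past_generators t : past_generators t `<=` measurable.
Proof.
move=> A [i _ [/measurable_sigma_gen_arm //|[B mB <-]]].
exact: measurable_funP.
Qed.

Lemma measurable_past_and_arm_generators t : past_and_arm_generators t `<=` measurable.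
Proof.
move=> A [pA|/measurable_sigma_gen_arm //].
exact: (g_sigma_measurable (@measurable_past_generators t) pA).
Qed.

Lemma past_sub_past_and_arm t : past x phi t `<=` past_and_arm x phi t.
Proof. by move=> A pA; apply: sub_sigma_algebra; left. Qed.

Lemma past_and_arm_sub_pastS t : past_and_arm x phi t `<=` past x phi t.+1.
Proof.
apply: smallest_sub; first exact: smallest_sigma_algebra.
move=> A [pA|xA]; last by apply: sub_sigma_algebra; exists t; [exact: ltnSn|left].
have S : past_generators t `<=` past_generators t.+1.
  by move=> B [i it iB]; exists i => //; exact: leqW it.
exact: (sub_sigma_algebra2 S pA).
Qed.

Lemma past_subS t : past x phi t `<=` past x phi t.+1.
Proof. by move=> A /past_sub_past_and_arm/past_and_arm_sub_pastS. Qed.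

Lemma measurable_past_arm t i j : (i < t)%N ->
  measurable_fun [set: g_sigma_algebraType (past_generators t)] (fun w => (x i w == j)%:R : R).
Proof.
move=> it.
rewrite (_ : (fun _ => _) = \1_(x i @^-1` [set j])); last first.
  apply/funext => w; rewrite indicE; congr (_ %:R); congr nat_of_bool.
  by apply/eqP/idP; rewrite inE.
apply: measurable_indic; apply: sub_sigma_algebra; exists i; [exact: it|left].
by exists [set j] => //; rewrite setTI.
Qed.

Lemma measurable_past_feedback t i : (i < t)%N ->
  measurable_fun [set: g_sigma_algebraType (past_generators t)] (phi i).
Proof.
move=> it _ B mB; apply: sub_sigma_algebra; exists i; [exact: it|right].
by exists B.
Qed.

Hypothesis nu_integrable :
  forall j, (nu j).-integrable setT (fun y : measurableTypeR R => y%:E).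
Hypothesis nu_mean : forall j, ('E_(nu j)[fun y => y] = (mu j)%:E)%E.
Hypothesis nu_variance : forall j, ('V_(nu j)[fun y => y] < +oo)%E.

Lemma feedback_lawE t j A B : past_and_arm x phi t A -> measurable (B : set (measurableTypeR R)) ->
  (P ((A `&` x t @^-1` [set j]) `&` phi t @^-1` B) =
   P (A `&` x t @^-1` [set j]) * nu j B)%E.
Proof.
move=> pA mB; have mj : past_and_arm x phi t (x t @^-1` [set j]).
  by apply: sub_sigma_algebra; right; exists [set j] => //; rewrite setTI.
have mAj : past_and_arm x phi t (A `&` x t @^-1` [set j]).
  exact: (@measurableI _ (g_sigma_algebraType (past_and_arm_generators t)) _ _ pA mj).
rewrite (feedback_law environment mAj mB).
have mF := g_sigma_measurable (@measurable_past_and_arm_generators t) mAj.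
rewrite (eq_integral (cst (nu j B))); last by move=> w; rewrite inE => -[_ /= ->].
have -> := integral_cst P mF (nu j B).
exact: muleC.
Qed.

Let dev j (y : R) := y - mu j.

Let dev_integrable j : (nu j).-integrable setT (fun y : measurableTypeR R => (dev j y)%:E).
Proof.
have ic := finite_measure_integrable_cst (nu j) (mu j) measurableT.
exact: (integrableB measurableT (nu_integrable j) ic).
Qed.

Let dev_mean j : (\int[nu j]_y (dev j y)%:E = 0)%E.
Proof.
have ic := finite_measure_integrable_cst (nu j) (mu j) measurableT.
have := nu_mean j; rewrite unlock => mj.
have H := @integralB _ _ _ (nu j) setT measurableT _ _ (nu_integrable j) ic.
have E := integral_cst (nu j) (@measurableT _ (measurableTypeR R)) (mu j)%:E.
have N1 := etrans (congr1 (fun z => (mu j)%:E * z)%E (probability_setT (nu j))) (mule1 _).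
apply: (etrans H); apply: (etrans (congr2 (fun a b => a - b)%E mj (etrans E N1))).
exact: subee.
Qed.

Let dev_sqr j : (\int[nu j]_y (dev j y ^+ 2)%:E < +oo)%E.
Proof.
have := nu_variance j; rewrite /variance unlock nu_mean /= unlock.
by under eq_integral => y _ do rewrite -[((_ \- _) * _) y]/(dev j y * dev j y) -expr2.
Qed.

(** The filtration includes the current arm, so the indicator of a pull of [j] is predictable and
    serves as [V]; its sum is the pull count, and [C] is the variance of arm j. *)
Lemma noise_fluctuates j : {ae P, forall w,
  fluctuates_below (noise (x^~ w) (phi^~ w) mu j) (pulls (x^~ w) j)}.
Proof.
pose G := past_and_arm_generators.
pose D t w : R := (x t w == j)%:R * dev j (phi t w).
pose V t w : R := (x t w == j)%:R.
pose C := fine (\int[nu j]_y (dev j y ^+ 2)%:E)%E.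
have GM t : G t `<=` measurable by exact: measurable_past_and_arm_generators.
have sub1 t : past x phi t.+1 `<=` <<s G t.+1>> by exact: past_sub_past_and_arm.
have GS t : <<s G t>> `<=` <<s G t.+1>>.
  by move=> A /past_and_arm_sub_pastS/sub1.
have mdev : measurable_fun setT (dev j) by exact: measurable_funB.
have mV t : measurable_fun [set: g_sigma_algebraType (G t)] (V t).
  rewrite /V (_ : (fun _ => _) = \1_(x t @^-1` [set j])); last first.
    apply/funext => w; rewrite indicE; congr (_ %:R); congr nat_of_bool.
    by apply/eqP/idP; rewrite inE.
  apply: measurable_indic; apply: sub_sigma_algebra; right.
  by exists [set j] => //; rewrite setTI.
have mD t : measurable_fun [set: g_sigma_algebraType (G t.+1)] (D t).
  have h : measurable_fun [set: g_sigma_algebraType (past_generators t.+1)] (D t).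
    apply: measurable_funM; first exact: measurable_past_arm.
    by apply: measurableT_comp => //; exact: measurable_past_feedback.
  by move=> _ B mB; apply: sub1; exact: (h measurableT B mB).
have V01 t w : 0 <= V t w <= 1 by rewrite /V; case: (_ == _) => /=; rewrite ?lexx ?ler01.
have dev2 : measurable_fun setT (fun y => dev j y ^+ 2) by exact: measurable_funX.
have C0 : 0 <= C by apply: fine_ge0; apply: integral_ge0 => y _; rewrite lee_fin sqr_ge0.
have CE : (C%:E = \int[nu j]_y (dev j y ^+ 2)%:E)%E.
  rewrite fineK // ge0_fin_numE //; apply: integral_ge0 => y _; rewrite lee_fin sqr_ge0 //.
have mphi t : measurable_fun setT (phi t : Omega -> R) by exact: measurable_funP.
have mA t A : <<s G t>> A -> measurable A by exact: (g_sigma_measurable (@GM t)).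
have mAj t A : <<s G t>> A -> measurable (A `&` x t @^-1` [set j]).
  by move=> /mA ?; apply: measurableI => //; exact: (arm_measurable environment).
have mDO t : measurable_fun setT (D t) by exact: (g_sigma_measurable_fun (@GM t.+1)).
have restr t A (g : R -> R) : g 0 = 0 -> <<s G t>> A -> (\int[P]_(w in A) (g (D t w))%:E =
    \int[P]_(w in A `&` x t @^-1` [set j]) (g (dev j (phi t w)))%:E)%E.
  move=> g0 GA; rewrite integral_mkcondr; apply: eq_integral => w wA.
  rewrite patchE /D; case: ifPn => [|/negP].
    by rewrite inE /= => ->; rewrite eqxx mul1r.
  rewrite inE /= => /eqP/negbTE ->; rewrite mul0r g0 //.
have sq t A : <<s G t>> A -> (\int[P]_(w in A) (D t w ^+ 2)%:E =
    P (A `&` x t @^-1` [set j]) * C%:E)%E.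
  move=> GA; rewrite (restr t A (fun y => y ^+ 2)) ?expr0n // CE.
  have law (B : set (measurableTypeR R)) (mB : measurable B) := feedback_lawE j GA mB.
  exact: (ge0_integral_law (mAj t A GA) (mphi t) law dev2 (fun y => sqr_ge0 _)).
have iD2 t : P.-integrable setT (EFin \o (fun w => D t w ^+ 2)).
  apply/integrableP; split; first by apply/measurable_EFinP; exact: measurable_funX.
  under eq_integral => w _ do rewrite /= ger0_norm ?sqr_ge0 //.
  have GT : <<s G t>> setT := @measurableT _ (g_sigma_algebraType (G t)).
  by rewrite (sq _ _ GT) ltey_eq fin_numM // fin_num_measure //; exact: mAj GT.
have D0 t A : <<s G t>> A -> (\int[P]_(w in A) (D t w)%:E = 0)%E.
  move=> GA; rewrite (restr t A id) //.
  have law (B : set (measurableTypeR R)) (mB : measurable B) := feedback_lawE j GA mB.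
  exact: (integral_law (mAj t A GA) (mphi t) law (dev_integrable j) (dev_mean j)).
have D2 t A : <<s G t>> A ->
    (\int[P]_(w in A) (D t w ^+ 2)%:E <= \int[P]_(w in A) (C * V t w)%:E)%E.
  move=> GA; rewrite sq //.
  have -> : (\int[P]_(w in A) (C * V t w)%:E = \int[P]_(w in A `&` x t @^-1` [set j]) C%:E)%E.
    rewrite integral_mkcondr; apply: eq_integral => w wA.
    rewrite patchE /V; case: ifPn => [|/negP].
      by rewrite inE /= => ->; rewrite eqxx mulr1.
    by rewrite inE /= => /eqP/negbTE ->; rewrite mulr0.
  have E := integral_cst P (mAj t A GA) C%:E.
  by rewrite (E : (\int[P]_(w in A `&` x t @^-1` [set j]) C%:E = _)%E) muleC.
have := martingale_cauchy GM GS mD mV V01 C0 iD2 D0 D2.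
apply: filterS => w /(@kronecker _ (D^~ w) (V^~ w)); apply.
by move=> t; case/andP: (V01 t w).
Qed.

Section agent.
Variables (Theta : set ('I_K -> R)) (c : bool).
Hypothesis regionE : forall j, argmax_region Theta j = mode_region c j.
Hypothesis agent : mints_agent x phi 1 Theta uniform_prior.

Let q j t w : R := posterior 1 Theta uniform_prior (observations (x^~ w) (phi^~ w) t) j.

(** The filtration is now the past alone, for which the posterior is measurable; it is the
    conditional mean of the pull indicator and also serves as [V]. *)
Lemma pulls_fluctuates j : {ae P, forall w,
  fluctuates_below (fun T => pulls (x^~ w) j T - \sum_(t < T) q j t w)
                   (fun T => \sum_(t < T) q j t w)}.
Proof.
pose G := past_generators.
have T0 k : argmax_region Theta k !=set0 by rewrite regionE; exists (fun=> 0) => ? ?.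
pose D t w : R := (x t w == j)%:R - q j t w.
have GM t : G t `<=` measurable by exact: measurable_past_generators.
have GS t : <<s G t>> `<=` <<s G t.+1>> by exact: past_subS.
have mq t : measurable_fun [set: g_sigma_algebraType (G t)] (q j t).
  apply: (measurable_posterior (T := g_sigma_algebraType (G t)) regionE) => i.
  - by move=> k it; exact: measurable_past_arm.
  - by move=> it; exact: measurable_past_feedback.
have mD t : measurable_fun [set: g_sigma_algebraType (G t.+1)] (D t).
  apply: measurable_funB; first exact: measurable_past_arm.
  by move=> _ B mB; apply: GS; exact: (mq t measurableT B mB).
have V01 t w : 0 <= q j t w <= 1.
  by rewrite posterior_le1 // andbT ltW // posterior_gt0.
have C0 : 0 <= 2 :> R by [].
have mA t A : <<s G t>> A -> measurable A by exact: (g_sigma_measurable (@GM t)).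
have mqO t : measurable_fun setT (q j t) by exact: (g_sigma_measurable_fun (@GM t)).
have mDO t : measurable_fun setT (D t) by exact: (g_sigma_measurable_fun (@GM t.+1)).
have mxj t : measurable (x t @^-1` [set j]) by exact: (arm_measurable environment).
have xE t : (fun w => (x t w == j)%:R : R) = \1_(x t @^-1` [set j]).
  apply/funext => w; rewrite indicE; congr (_ %:R); congr nat_of_bool.
  by apply/eqP/idP; rewrite inE.
have ix t : P.-integrable setT (EFin \o (fun w => (x t w == j)%:R : R)).
  by rewrite xE; exact: integrable_indic.
have iq t : P.-integrable setT (EFin \o q j t).
  have i1 := finite_measure_integrable_cst P 1 measurableT.
  apply: (le_integrable measurableT _ _ i1); first exact/measurable_EFinP.
  move=> w _ /=; rewrite lee_fin normr1; case/andP: (V01 t w) => q0 q1.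
  by rewrite ger0_norm.
(* Over any event of the past the indicator and [q] have equal integrals, so this bound becomes the
   constant [C] = 2. *)
have Dle t w : D t w ^+ 2 <= (x t w == j)%:R + q j t w.
  by rewrite /D; case/andP: (V01 t w) => q0 q1; case: (_ == _) => /=; nra.
have ixq t : P.-integrable setT (EFin \o (fun w => (x t w == j)%:R + q j t w)).
  exact: (integrableD measurableT (ix t) (iq t)).
have iD2 t : P.-integrable setT (EFin \o (fun w => D t w ^+ 2)).
  apply: (le_integrable measurableT _ _ (ixq t)).
    by apply/measurable_EFinP; exact: measurable_funX.
  move=> w _ /=; rewrite lee_fin ger0_norm ?sqr_ge0 //.
  by apply: le_trans (Dle t w) _; exact: ler_norm.
have IS (A : set Omega) f : measurable A -> P.-integrable setT (EFin \o f) ->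
    P.-integrable A (EFin \o f) by move=> ? ?; apply: integrableS (_ : P.-integrable setT _).
have xq t A : <<s G t>> A ->
    (\int[P]_(w in A) ((x t w == j)%:R)%:E = \int[P]_(w in A) (q j t w)%:E)%E.
  move=> GA; rewrite -(agent j GA).
  under eq_integral => w _ do rewrite -[(x t w == j)%:R]/((fun w => (x t w == j)%:R : R) w) xE.
  by have mA' := mA t A GA; rewrite integral_indic // setIC.
have fq t A : <<s G t>> A -> (\int[P]_(w in A) (q j t w)%:E)%E \is a fin_num.
  by move=> GA; apply: integrable_fin_num; [exact: (mA t A GA)|exact: (IS _ _ (mA t A GA))].
have D0 t A : <<s G t>> A -> (\int[P]_(w in A) (D t w)%:E = 0)%E.
  move=> GA; have mA' := mA t A GA.
  rewrite integralB_EFin //; [|exact: IS|exact: IS].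
  by rewrite xq // subee // fq.
have D2 t A : <<s G t>> A ->
    (\int[P]_(w in A) (D t w ^+ 2)%:E <= \int[P]_(w in A) (2 * q j t w)%:E)%E.
  move=> GA; have mA' := mA t A GA.
  have -> : (\int[P]_(w in A) (2 * q j t w)%:E =
      \int[P]_(w in A) ((x t w == j)%:R + q j t w)%:E)%E.
    rewrite integralD_EFin //; [|exact: IS|exact: IS].
    rewrite xq // -integralD_EFin //; [|exact: IS|exact: IS].
    by apply: eq_integral => w _; congr EFin; ring.
  apply: le_integral => //; [exact: (IS _ _ mA' (iD2 t))|exact: (IS _ _ mA' (ixq t))|].
  by move=> w _; rewrite lee_fin.
have := martingale_cauchy GM GS mD mq V01 C0 iD2 D0 D2.
apply: filterS => w /(@kronecker _ (D^~ w) (q j ^~ w)).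
have q0 t : 0 <= q j t w by case/andP: (V01 t w).
move=> /(_ q0); rewrite (_ : (fun n => \sum_(t < n) D t w) =
  fun T => pulls (x^~ w) j T - \sum_(t < T) q j t w) //.
by apply/funext => n; rewrite /D sumrB.
Qed.

Variable p : 'I_K.
Hypothesis p_best : forall j, j != p -> mu j < mu p.
Hypothesis Theta_mu : Theta mu.

Lemma gapE j : gap mu j = mu p - mu j.
Proof.
have pmax k : mu k <= mu p by have [->|/p_best/ltW] := eqVneq k p.
rewrite /gap; congr (_ - _); apply/eqP; rewrite eq_le le_bigmax_cond // andbT.
by apply/bigmax_leP; split.
Qed.

Lemma regretE T w : regret x mu T w = \sum_(j | j != p) gap mu j * pulls (x^~ w) j T.
Proof.
have -> : regret x mu T w = \sum_j gap mu j * pulls (x^~ w) j T.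
  under [RHS]eq_bigr do rewrite mulr_sumr.
  rewrite exchange_big /=; apply: eq_bigr => i _.
  rewrite (bigD1 (x i w)) //= eqxx mulr1 big1 ?addr0 // => k.
  by rewrite eq_sym => /negbTE ->; rewrite mulr0.
by rewrite (bigD1 p) //= gapE subrr mul0r add0r.
Qed.

Lemma regret_asymptotics :
  {ae P, forall w, (fun T => regret x mu T w / ln T%:R) @ \oo -->
    \sum_(j < K | (j != p) && adjacent c j p) 2 / gap mu j}.
Proof.
have mu_p : mode_region c p mu.
  rewrite -regionE; split => // k.
  by have [->|/p_best/ltW] := eqVneq k p.
have noise_ae : {ae P, forall w, forall j,
    fluctuates_below (noise (x^~ w) (phi^~ w) mu j) (pulls (x^~ w) j)}.
  by apply: filter_forall => j; exact: noise_fluctuates.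
have pulls_ae : {ae P, forall w, forall j,
    fluctuates_below (fun T => pulls (x^~ w) j T - \sum_(t < T) q j t w)
                     (fun T => \sum_(t < T) q j t w)}.
  by apply: filter_forall => j; exact: pulls_fluctuates.
apply: filterS2 noise_ae pulls_ae => w noise_w pulls_w.
have lim j : j != p -> (fun T => gap mu j * (pulls (x^~ w) j T / ln T%:R)) @ \oo -->
    (if adjacent c j p then 2 / gap mu j else 0).
  move=> jp; have := pulls_asymptotics regionE mu_p p_best noise_w pulls_w jp.
  move=> /(cvgMl_tmp (a := gap mu j)) /cvg_trans; apply.
  have g0 : mu p - mu j != 0 by rewrite subr_eq0 gt_eqF // p_best.
  rewrite gapE; case: ifP => _; last by rewrite mulr0.
  by have -> : (mu p - mu j) * (2 / (mu p - mu j) ^+ 2) = 2 / (mu p - mu j) by field.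
have -> : (fun T => regret x mu T w / ln T%:R) =
    fun T => \sum_(j | j != p) gap mu j * (pulls (x^~ w) j T / ln T%:R).
  by apply/funext => T; rewrite regretE mulr_suml; apply: eq_bigr => j _; rewrite mulrA.
rewrite big_mkcondr; exact: cvg_finite_sum.
Qed.

End agent.
End bandit.

(** * Identification of the two parameter spaces with mode regions *)

Lemma argmax_region_setT (R : realType) (K : nat) (j : 'I_K) :
  argmax_region [set: 'I_K -> R] j = mode_region true j.
Proof.
apply/seteqP; split => v.
  by move=> [_ vj] k i; rewrite /btw => /orP[/eqP ->|/eqP ->].
by move=> jv; split => // k; apply: jv; exact: btw_end.
Qed.

(** A unimodal profile may be presented with a peak [p] other than the maximiser [j]; between the
    two it is constant, so [j] is a peak as well. *)
Lemma argmax_region_unimodal (R : realType) (K : nat) (j : 'I_K) :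
  argmax_region (@unimodal_set R K) j = mode_region false j.
Proof.
apply/seteqP; split => v.
  move=> [[p _ [inc dec]] vj] k i; rewrite /btw => /orP[/andP[ki ij]|/andP[ji ik]].
    have [ip|/ltnW pi] := leqP i p; first by apply: inc; rewrite ki.
    by apply: le_trans (vj k) _; apply: dec; rewrite pi.
  have [pi|/ltnW ip] := leqP p i; first by apply: dec; rewrite pi.
  by apply: le_trans (vj k) _; apply: inc; rewrite ji.
move=> jv; split; last by move=> k; apply: jv; exact: btw_end.
exists j => //; split => i k ik; apply: jv; rewrite /btw; first by rewrite ik.
by apply/orP; right.
Qed.

Theorem theorem4p4 (R : realType) (K : nat)
  (nu : 'I_K -> probability (measurableTypeR R) R) (mu : 'I_K -> R)
  (jstar : 'I_K) (Theta : set ('I_K -> R))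
  (d : measure_display) (Omega : measurableType d) (P : probability Omega R)
  (x : nat -> Omega -> 'I_K) (phi : nat -> {RV P >-> R})
  (nu_integrable : forall j, (nu j).-integrable setT (fun y : measurableTypeR R => y%:E))
  (nu_mean : forall j, ('E_(nu j)[fun y => y] = (mu j)%:E)%E)
  (nu_variance : forall j, ('V_(nu j)[fun y => y] < +oo)%E)
  (jstar_best : forall j, j != jstar -> mu j < mu jstar)
  (mu_Theta : Theta mu)
  (environment : bandit_environment x phi nu)
  (agent : mints_agent x phi 1 Theta uniform_prior) :
  (Theta = setT ->
     {ae P, forall w, (fun T => regret x mu T w / ln T%:R) @ \oo -->
       \sum_(j < K | j != jstar) 2 / gap mu j})
  /\
  (Theta = unimodal_set ->
     {ae P, forall w, (fun T => regret x mu T w / ln T%:R) @ \oo -->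
       \sum_(j < K | `|(j : nat)%:Z - (jstar : nat)%:Z| == 1) 2 / gap mu j}).

Proof.
split=> ThetaE.
  have regionE j : argmax_region Theta j = mode_region true j.
    by rewrite ThetaE argmax_region_setT.
  have := regret_asymptotics environment nu_integrable nu_mean nu_variance regionE agent
    jstar_best mu_Theta.
  rewrite (eq_bigl (fun j => j != jstar)) // => j.
  by rewrite /adjacent andbb.
have regionE j : argmax_region Theta j = mode_region false j.
  by rewrite ThetaE argmax_region_unimodal.
have := regret_asymptotics environment nu_integrable nu_mean nu_variance regionE agent
  jstar_best mu_Theta.
rewrite (eq_bigl (fun j : 'I_K => `|(j : nat)%:Z - (jstar : nat)%:Z| == 1)) // => j.
by rewrite /adjacent -(inj_eq val_inj) /=; lia.
Qed.
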